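(* Let $M^2$ be a CMC biconservative surface in a complex space form $N^2(c)$ of complex dimension $2$ ($c\in\mathbb R$), with non-vanishing mean curvature vector field $H$, and let $T$ be the tangential part of $JH$. If $JT$ is normal to $M^2$, then $M^2$ is PMC and totally real.
   Context: A surface is an oriented manifold of real dimension $2$. A complex space form $N^n(c)$ is a Kähler manifold of complex dimension $n$, with complex structure $J$, and constant holomorphic sectional curvature $c$. Submanifolds $\phi:M^m\to N$ are isometric immersions; $B$ is the second fundamental form, $H=\frac1m\operatorname{trace}B$ the mean curvature vector field, $\nabla^\perp$ the normal connection. $M$ is CMC if $|H|$ is constant, PMC if $\nabla^\perp H=0$, totally real if $J(TM)$ is contained in the normal bundle of $M$. The tension field is $\tau(\phi)=\operatorname{trace}\nabla d\phi=mH$ and the bitension field is $\tau_2(\phi)=-\Delta\tau(\phi)-\operatorname{trace}\overline R(d\phi(\cdot),\tau(\phi))d\phi(\cdot)$, where $\Delta=-\operatorname{trace}\nabla^2$ and $\overline R(X,Y)Z=\overline\nabla_X\overline\nabla_YZ-\overline\nabla_Y\overline\nabla_XZ-\overline\nabla_{[X,Y]}Z$ is the curvature tensor of $N$. $M$ is biconservative if the tangential part of $\tau_2(\phi)$ vanishes. *)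

(* Defs.v *)
From HB Require Import structures.
From mathcomp Require Import all_boot all_order all_algebra.
From mathcomp Require Import all_classical all_reals all_analysis.

Set Implicit Arguments.
Unset Strict Implicit.
Unset Printing Implicit Defensive.
Import Order.TTheory GRing.Theory Num.Theory.
Import numFieldNormedType.Exports.
Local Open Scope classical_set_scope.
Local Open Scope ring_scope.

(* Differential geometry is done in charts: a tensor field is the family
   of its components in the charts of an atlas.  Tangent vectors are row
   vectors of components and linear maps act on the right, so the Jacobian matrix of f has the partial derivatives of f as its rows.
   Functions attached to a chart are total on 'rV[R]_n; their values outside
   the (open) image of the chart are irrelevant. *)

Definition pd (R : realType) (n : nat) (i : 'I_n) (f : 'rV[R]_n -> R)
    (u : 'rV[R]_n) : R := 'D_('e_i) f u.

(* C^oo on the open set U: every iterated partial derivative of f (including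
   f itself) is differentiable at every point of U. *)
Definition smooth_on (R : realType) (n : nat) (U : set 'rV[R]_n)
    (f : 'rV[R]_n -> R) : Prop :=
  forall (s : seq 'I_n) (u : 'rV[R]_n),
    U u -> differentiable (foldr (@pd R n) f s) u.

Definition jac (R : realType) (m n : nat) (f : 'rV[R]_m -> 'rV[R]_n)
    (u : 'rV[R]_m) : 'M[R]_(m, n) :=
  \matrix_(i, a) pd i (fun v => f v 0 a) u.

Record chart (R : realType) (M : topologicalType) (n : nat) := Chart {
  chart_dom : set M;
  chart_img : set 'rV[R]_n;
  chart_map : M -> 'rV[R]_n;
  chart_inv : 'rV[R]_n -> M;
  chart_dom_open : open chart_dom;
  chart_img_open : open chart_img;
  chart_mapP : forall p, chart_dom p ->
    chart_img (chart_map p) /\ chart_inv (chart_map p) = p;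
  chart_invP : forall u, chart_img u ->
    chart_dom (chart_inv u) /\ chart_map (chart_inv u) = u;
  chart_map_continuous : {within chart_dom, continuous chart_map};
  chart_inv_continuous : {within chart_img, continuous chart_inv}
}.

Section LocalRepresentatives.
Context (R : realType) (M N : topologicalType) (m n : nat).

Definition locrep (phi : M -> N) (x : chart R M m) (y : chart R N n)
    (u : 'rV[R]_m) : 'rV[R]_n := chart_map y (phi (chart_inv x u)).

Definition locdom (phi : M -> N) (x : chart R M m) (y : chart R N n) :
    set 'rV[R]_m :=
  [set u | chart_img x u /\ chart_dom y (phi (chart_inv x u))].

End LocalRepresentatives.

Section Transition.
Context (R : realType) (M : topologicalType) (n : nat).

Definition transition (x y : chart R M n) : 'rV[R]_n -> 'rV[R]_n :=
  locrep (fun p : M => p) x y.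

Definition overlap (x y : chart R M n) : set 'rV[R]_n :=
  locdom (fun p : M => p) x y.

End Transition.

Record smooth_manifold (R : realType) (n : nat) := SmoothManifold {
  mcarrier :> topologicalType;
  mcharts : set (chart R mcarrier n);
  mhausdorff : hausdorff_space mcarrier;
  msecond_countable : @second_countable mcarrier;
  mcover : forall p : mcarrier, exists2 x, mcharts x & chart_dom x p;
  mcompat : forall x y, mcharts x -> mcharts y -> forall a : 'I_n,
    smooth_on (overlap x y) (fun u => transition x y u 0 a)
}.
Arguments mcharts {R n} s.

(* The atlas of M is an oriented atlas, so that M is an oriented manifold. *)
Definition oriented (R : realType) (n : nat) (M : smooth_manifold R n) : Prop :=
  forall x y, mcharts M x -> mcharts M y ->
    forall u, overlap x y u -> 0 < \det (jac (transition x y) u).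

(* Multiplication by the imaginary unit: R^(n + n) is identified with C^n by
   (x, y) |-> x + iy, hence J (d/dx_k) = d/dy_k and J (d/dy_k) = - d/dx_k. *)
Definition Jmx (R : realType) (n : nat) : 'M[R]_(n + n) :=
  block_mx 0 1%:M (- 1%:M) 0.

(* Complex manifold of complex dimension n: the Cauchy-Riemann equations say
   that the transition maps are holomorphic.  The complex structure J of the
   tangent spaces is Jmx in each chart. *)
Record complex_manifold (R : realType) (n : nat) := ComplexManifold {
  cmanifold :> smooth_manifold R (n + n);
  cholomorphic : forall x y, mcharts cmanifold x -> mcharts cmanifold y ->
    forall u, overlap x y u ->
      Jmx R n *m jac (transition x y) u = jac (transition x y) u *m Jmx R n
}.

Record riem_metric (R : realType) (n : nat) (M : smooth_manifold R n) :=
RiemMetric {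
  gmx :> chart R M n -> 'rV[R]_n -> 'M[R]_n;
  gmx_smooth : forall x, mcharts M x -> forall i j : 'I_n,
    smooth_on (chart_img x) (fun u => gmx x u i j);
  gmx_sym : forall x, mcharts M x -> forall u, chart_img x u ->
    (gmx x u)^T = gmx x u;
  gmx_pos : forall x, mcharts M x -> forall u, chart_img x u ->
    forall v : 'rV[R]_n, v != 0 -> 0 < (v *m gmx x u *m v^T) 0 0;
  gmx_transition : forall x y, mcharts M x -> mcharts M y ->
    forall u, overlap x y u ->
      gmx x u = jac (transition x y) u *m gmx y (transition x y u)
                *m (jac (transition x y) u)^T
}.

Section OneMetric.
Context (R : realType) (n : nat).
Implicit Types (h : 'rV[R]_n -> 'M[R]_n) (p v w X Y Z : 'rV[R]_n).

Definition ip h p v w : R := (v *m h p *m w^T) 0 0.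

Definition christoffel h p (a b l : 'I_n) : R :=
  2^-1 * \sum_s invmx (h p) l s *
    (pd a (fun q => h q b s) p + pd b (fun q => h q a s) p
     - pd s (fun q => h q a b) p).

(* The pull-back of the Levi-Civita connection of h by a map f: this is the
   covariant derivative of the vector field V along f in the direction of the
   i-th coordinate vector field.  It is the Levi-Civita connection itself when
   f is the identity. *)
Definition covD (m : nat) h (f : 'rV[R]_m -> 'rV[R]_n) (i : 'I_m)
    (V : 'rV[R]_m -> 'rV[R]_n) (u : 'rV[R]_m) : 'rV[R]_n :=
  \row_l (pd i (fun q => V q 0 l) u
          + \sum_a \sum_b christoffel h (f u) a b l * jac f u i a * V u 0 b).

(* Coordinate vector fields commute, so there is no bracket term. *)
Definition curv h p X Y Z : 'rV[R]_n :=
  \sum_a \sum_b \sum_d (X 0 a * Y 0 b * Z 0 d) *: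
    (covD h id a (covD h id b (fun=> 'e_d)) p
     - covD h id b (covD h id a (fun=> 'e_d)) p).

Definition sec_curv h p X Y : R :=
  ip h p (curv h p X Y Y) X
    / (ip h p X X * ip h p Y Y - ip h p X Y ^+ 2).

End OneMetric.

(* Kaehler manifold: the metric is Hermitian and J is parallel with respect to
   the Levi-Civita connection. *)
Definition kahler (R : realType) (n : nat) (N : complex_manifold R n)
    (h : riem_metric N) : Prop :=
  forall y, mcharts N y -> forall p, chart_img y p ->
    (forall X Y : 'rV[R]_(n + n),
       ip (h y) p (X *m Jmx R n) (Y *m Jmx R n) = ip (h y) p X Y) /\
    (forall a b : 'I_(n + n),
       covD (h y) id a (fun=> 'e_b *m Jmx R n) p
       = covD (h y) id a (fun=> 'e_b) p *m Jmx R n).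

Definition complex_space_form (R : realType) (n : nat)
    (N : complex_manifold R n) (h : riem_metric N) (c : R) : Prop :=
  kahler h /\
  forall y, mcharts N y -> forall p, chart_img y p ->
    forall X : 'rV[R]_(n + n), X != 0 ->
      sec_curv (h y) p X (X *m Jmx R n) = c.

(* Here f is a map between open subsets of R^m and R^n with metrics g and h. *)
Section Immersion.
Context (R : realType) (m n : nat).
Context (g : 'rV[R]_m -> 'M[R]_m) (h : 'rV[R]_n -> 'M[R]_n).
Context (f : 'rV[R]_m -> 'rV[R]_n).
Implicit Types (u X : 'rV[R]_m) (v : 'rV[R]_n) (V : 'rV[R]_m -> 'rV[R]_n).

Definition dmap u X : 'rV[R]_n := X *m jac f u.

Definition gtrace u (S : 'I_m -> 'I_m -> 'rV[R]_n) : 'rV[R]_n :=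
  \sum_i \sum_j invmx (g u) i j *: S i j.

Definition is_normal u v : Prop := forall X, ip h (f u) v (dmap u X) = 0.

Definition tan_part u v : 'rV[R]_n :=
  gtrace u (fun i j => ip h (f u) v (dmap u 'e_i) *: dmap u 'e_j).

Definition nor_part u v : 'rV[R]_n := v - tan_part u v.

(* The second fundamental form B = nabla d f on coordinate vector fields: by
   the Gauss formula it is the difference of the two connections. *)
Definition sff (i j : 'I_m) u : 'rV[R]_n :=
  covD h f i (fun q => dmap q 'e_j) u - dmap u (covD g id i (fun=> 'e_j) u).

Definition tension u : 'rV[R]_n := gtrace u (fun i j => sff i j u).

Definition mean_curv u : 'rV[R]_n :=
  m%:R^-1 *: gtrace u (fun i j => sff i j u).

(* The normal connection, for normal vector fields V. *)
Definition norD (i : 'I_m) V u : 'rV[R]_n := nor_part u (covD h f i V u).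

(* The second covariant derivative nabla^2 V on coordinate vector fields. *)
Definition covD2 (i j : 'I_m) V u : 'rV[R]_n :=
  covD h f i (covD h f j V) u
  - \sum_l covD g id i (fun=> 'e_j) u 0 l *: covD h f l V u.

Definition rough_laplacian V u : 'rV[R]_n :=
  - gtrace u (fun i j => covD2 i j V u).

Definition bitension u : 'rV[R]_n :=
  - rough_laplacian tension u
  - gtrace u (fun i j =>
      curv h (f u) (dmap u 'e_i) (tension u) (dmap u 'e_j)).

End Immersion.

(* The notions below are independent of the charts, which allows stating them
   in every pair of charts x of M and y of N, at every point u of the domain
   of the expression [locrep phi x y] of phi. *)
Section Submanifold.
Context (R : realType) (m n : nat).
Context (M : smooth_manifold R m) (g : riem_metric M).

Definition in_charts (N : smooth_manifold R n) (phi : M -> N)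
    (P : chart R M m -> chart R N n -> 'rV[R]_m -> Prop) : Prop :=
  forall x y, mcharts M x -> mcharts N y ->
    forall u, locdom phi x y u -> P x y u.

Section Riemannian.
Context (N : smooth_manifold R n) (h : riem_metric N) (phi : M -> N).

Definition smooth_map : Prop :=
  continuous phi /\
  forall x y, mcharts M x -> mcharts N y -> forall a : 'I_n,
    smooth_on (locdom phi x y) (fun u => locrep phi x y u 0 a).

Definition isometric_immersion : Prop :=
  smooth_map /\
  in_charts phi (fun x y u => forall X Y : 'rV[R]_m,
    let f := locrep phi x y in
    ip (h y) (f u) (dmap f u X) (dmap f u Y) = ip (g x) u X Y).

Definition meanH (x : chart R M m) (y : chart R N n) : 'rV[R]_m -> 'rV[R]_n :=
  mean_curv (g x) (h y) (locrep phi x y).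

Definition CMC : Prop :=
  exists r : R, in_charts phi (fun x y u =>
    Num.sqrt (ip (h y) (locrep phi x y u) (meanH x y u) (meanH x y u)) = r).

Definition PMC : Prop :=
  in_charts phi (fun x y u => forall i : 'I_m,
    norD (g x) (h y) (locrep phi x y) i (meanH x y) u = 0).

Definition nonvanishing_mean_curvature : Prop :=
  in_charts phi (fun x y u => meanH x y u != 0).

Definition biconservative : Prop :=
  in_charts phi (fun x y u =>
    let f := locrep phi x y in
    tan_part (g x) (h y) f u (bitension (g x) (h y) f u) = 0).

End Riemannian.
End Submanifold.

Section ComplexAmbient.
Context (R : realType) (m n : nat).
Context (M : smooth_manifold R m) (g : riem_metric M).
Context (N : complex_manifold R n) (h : riem_metric N) (phi : M -> N).

Definition totally_real : Prop :=
  in_charts phi (fun x y u => forall X : 'rV[R]_m,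
    let f := locrep phi x y in
    is_normal (h y) f u (dmap f u X *m Jmx R n)).

Definition tanJH (x : chart R M m) (y : chart R N (n + n)) (u : 'rV[R]_m) :
    'rV[R]_(n + n) :=
  tan_part (g x) (h y) (locrep phi x y) u (meanH g h phi x y u *m Jmx R n).

Definition JT_normal : Prop :=
  in_charts phi (fun x y u =>
    is_normal (h y) (locrep phi x y) u (tanJH x y u *m Jmx R n)).

End ComplexAmbient.

(* Main.v *)
Require Import Defs.
From HB Require Import structures.
From mathcomp Require Import all_boot all_order all_algebra.
From mathcomp Require Import all_classical all_reals all_analysis.
From mathcomp Require Import ring lra.

(** Fix a chart of the surface and a chart of the ambient space, and work with
    the immersion f between open subsets of R^2 and R^4.  Let E_0, E_1 be the
    coordinate tangent vectors, B the second fundamental form, r = |H|, and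
    let J act by the constant matrix of the complex chart.

    Totally real.  Write T = (JH)^tan and k = <J E_0, E_1>.  That JT is normal
    means that k T = 0.  If k were nonzero at a point, T would vanish on a
    neighbourhood, where JH is then normal and the tangent planes, being
    orthogonal to H and JH, are J-invariant.  There J E_j is tangent and
    differentiating <J E_j, H> = 0 gives <B(X, Y), JH> = - <B(X, JY), H>; since
    the left side is symmetric in X and Y, the trace of <B, H> vanishes, which
    contradicts H <> 0 ([kahler_form01_eq0]).  Hence k = 0 everywhere.

    Parallel mean curvature.  JH is now tangent, of constant length r, and
    e1 = JH / r, e2, e3 = J e1, e4 = J e2 is an orthonormal moving frame along
    f with e1, e2 tangent and H = - r e3.  As J is parallel, the connection of
    the frame is given by the 1-forms omega = <D e1, e2> and
    alpha = <D e1, e3>, beta = <D e1, e4> = <D e2, e3>, gamma = <D e2, e4>.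
    The normal derivative of H is - r omega e4, so omega = 0 is the claim.

    A space form has no curvature component <R(X, Y) Z, JW> on a totally real
    plane, hence d alpha = 2 omega ^ beta, d gamma = - 2 omega ^ beta and
    d beta = omega ^ gamma - omega ^ alpha.  The trace of B gives
    alpha + gamma = - 2 r theta1 for the coframe theta1, theta2 dual to e1, e2,
    so theta1 is closed and omega = rho theta2 for a function rho.  In terms of
    the cubic form c_ijk = <B(e_i, e_j), J e_k>, these equations together with
    the two tangential components of the bitension field give
    rho c112 = 0 and rho c122 = 0 ([rho_c112], [rho_c122]).  Where rho <> 0,
    c112 = c122 = 0 on a neighbourhood and c111 = - 2 r is constant there, and
    the e1-component of the bitension field reads c111 rho = 0, a
    contradiction ([rho_eq0]).

    The differential geometry used on the way is established in coordinates:
    smooth functions are closed under the usual operations and have symmetric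
    second derivatives ([pdC]), the pulled-back Levi-Civita connection is metric
    and torsion free and has the pulled-back curvature ([pd_ip],
    [torsion_free], [covD_curv]), and constant holomorphic sectional curvature
    determines the curvature tensor ([curv_space_form]). *)

Set Implicit Arguments.
Unset Strict Implicit.
Unset Printing Implicit Defensive.
Import Order.TTheory GRing.Theory Num.Theory.
Import numFieldNormedType.Exports.
Local Open Scope classical_set_scope.
Local Open Scope ring_scope.

(** * Rules for partial derivatives *)

Lemma differentiable_near (R : realType) (V W : normedModType R)
  (f g : V -> W) u : {near u, f =1 g} ->
  differentiable f u -> differentiable g u.
Proof.
move=> fg df; have [dfc dfE] := (diff_locallyP _ _).1 df.
have gE : g \o shift u = cst (g u) + 'd f u +o_ 0 id.
  apply/eqaddoP => e e0; move/eqaddoP: dfE => /(_ e e0).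
  have : \forall x \near 0, f (x + u) = g (x + u).
    by move: fg; rewrite (near_shift 0 u) /=; apply: filterS => x; rewrite /= subr0.
  apply: filterS2 => x /= fgx.
  by rewrite !fctE /= fgx (nbhs_singleton fg).
by apply/diff_locallyP; rewrite (diff_unique dfc gE).
Qed.

Section PartialDerivatives.
Context (R : realType) (n : nat).
Implicit Types (f g : 'rV[R]_n -> R) (u : 'rV[R]_n) (i : 'I_n).

Lemma pd_near i f g u : {near u, f =1 g} -> pd i f u = pd i g u.
Proof. by move=> fg; rewrite /pd; apply: near_eq_derive => //;
  apply: nbhs_singleton. Qed.

Lemma pd_cst i (c : R) u : pd i (fun=> c) u = 0.
Proof. exact: derive_cst. Qed.

Lemma pdD i f g u : differentiable f u -> differentiable g u ->
  pd i (fun v => f v + g v) u = pd i f u + pd i g u.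
Proof. by move=> df dg; apply: deriveD; apply: diff_derivable. Qed.

Lemma pdN i f u : differentiable f u -> pd i (fun v => - f v) u = - pd i f u.
Proof. by move=> df; apply: deriveN; apply: diff_derivable. Qed.

Lemma pdM i f g u : differentiable f u -> differentiable g u ->
  pd i (fun v => f v * g v) u = pd i f u * g u + f u * pd i g u.
Proof.
move=> df dg; rewrite /pd (deriveM (diff_derivable df) (diff_derivable dg)).
by rewrite addrC /GRing.scale /= mulrC.
Qed.

Lemma pdV i f u : f u != 0 -> differentiable f u ->
  pd i (fun v => (f v)^-1) u = - (pd i f u * (f u)^-1 * (f u)^-1).
Proof.
move=> f0 df; rewrite /pd (deriveV f0 (diff_derivable df)).
by rewrite /GRing.scale /= mulNr expr2 invfM mulrC mulrA.
Qed.

Lemma differentiable_sqrt f u : 0 < f u -> differentiable f u ->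
  differentiable (fun v => Num.sqrt (f v)) u.
Proof.
move=> f0 df; apply: (@differentiable_comp _ _ _ _ f (@Num.sqrt R)) => //.
by apply/derivable1_diffP; have [] := is_derive1_sqrt f0.
Qed.

(** Differentiate the identity sqrt f * sqrt f = f, valid near u as f u > 0. *)
Lemma pd_sqrt i f u : 0 < f u -> differentiable f u ->
  pd i (fun v => Num.sqrt (f v)) u = pd i f u * 2^-1 * (Num.sqrt (f u))^-1.
Proof.
move=> f0 df.
have sq0 : 0 < Num.sqrt (f u) by rewrite sqrtr_gt0.
have ds := differentiable_sqrt f0 df.
have : pd i (fun v => Num.sqrt (f v) * Num.sqrt (f v)) u = pd i f u.
  apply: pd_near; have cf := differentiable_continuous df.
  have : \forall v \near u, 0 < f v by exact: (cvgr_gt (f u) cf 0 f0).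
  by apply: filterS => v fv; rewrite -expr2 sqr_sqrtr // ltW.
rewrite pdM // => <-; field; exact: lt0r_neq0.
Qed.

Lemma differentiable_sum_seq (I : Type) (r : seq I) (F : I -> 'rV[R]_n -> R) u :
  (forall a, differentiable (F a) u) ->
  differentiable (fun v => \sum_(a <- r) F a v) u.
Proof.
move=> dF; elim: r => [|a r IH].
  under eq_fun do rewrite big_nil; exact: differentiable_cst.
under eq_fun do rewrite big_cons; exact: differentiableD.
Qed.

Lemma pd_sum (I : Type) (r : seq I) i (F : I -> 'rV[R]_n -> R) u :
  (forall a, differentiable (F a) u) ->
  pd i (fun v => \sum_(a <- r) F a v) u = \sum_(a <- r) pd i (F a) u.
Proof.
move=> dF; elim: r => [|a r IH].
  rewrite big_nil; under eq_fun do rewrite big_nil; exact: pd_cst.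
rewrite big_cons -IH; under eq_fun do rewrite big_cons.
by rewrite pdD //; apply: differentiable_sum_seq.
Qed.

End PartialDerivatives.

Lemma differentiable_row (R : realType) (m n : nat)
    (f : 'rV[R]_m -> 'rV[R]_n) u :
  (forall a, differentiable (fun v => f v 0 a) u) -> differentiable f u.
Proof.
move=> df.
have -> : f = \sum_(a < n) (fun v => f v 0 a *: 'e_a).
  by apply/funext => v; rewrite fct_sumE; apply: row_sum_delta.
by apply: differentiable_sum => a; apply: differentiableZl.
Qed.

Lemma pd_comp (R : realType) (m n : nat) i (k : 'rV[R]_n -> R)
    (f : 'rV[R]_m -> 'rV[R]_n) u :
  (forall a, differentiable (fun v => f v 0 a) u) -> differentiable k (f u) ->
  pd i (fun v => k (f v)) u = \sum_a pd a k (f u) * pd i (fun v => f v 0 a) u.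
Proof.
move=> df dk; have dfr := differentiable_row df.
rewrite /pd deriveE; last exact: differentiable_comp.
rewrite (diff_comp dfr dk) /= -(deriveE _ dfr) (derive_mx (diff_derivable dfr)).
set w := \matrix_(_, _) _; rewrite {1}(row_sum_delta w) linear_sum.
by apply: eq_bigr => a _; rewrite linearZ /= -(deriveE _ dk) mulrC !mxE.
Qed.

Lemma differentiable_comp_row (R : realType) (m n : nat) (k : 'rV[R]_n -> R)
    (f : 'rV[R]_m -> 'rV[R]_n) u :
  (forall a, differentiable (fun v => f v 0 a) u) -> differentiable k (f u) ->
  differentiable (fun v => k (f v)) u.
Proof.
by move=> df dk; apply: differentiable_comp => //; apply: differentiable_row.
Qed.

(** * Smooth functions on an open set *)

Section Smoothness.
Context (R : realType) (n : nat).
Implicit Types (U : set 'rV[R]_n) (f g : 'rV[R]_n -> R) (u : 'rV[R]_n) (i : 'I_n).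

(** Differentiability of the partial derivatives up to order k.  Smoothness is
    the conjunction over k ([smooth_onP]), and each closure property is proved
    by induction on k: the derivative of a product, composite, etc. is a
    polynomial in functions of class k and the operation itself one order
    lower. *)
Fixpoint Ck (k : nat) U f : Prop :=
  (forall u, U u -> differentiable f u) /\
  if k is k'.+1 then forall i, Ck k' U (pd i f) else True.

Lemma Ck_diff k U f : Ck k U f -> forall u, U u -> differentiable f u.
Proof. by case: k => [|k] /= []. Qed.

Lemma Ck_pd k U f i : Ck k.+1 U f -> Ck k U (pd i f).
Proof. by move=> /= []. Qed.

Lemma CkS k U f : Ck k.+1 U f -> Ck k U f.
Proof.
elim: k f => [|k IH] f [df dk] /=; first by split.
by split=> // i; apply: IH; apply: dk.
Qed.

Lemma smooth_on_pd U f i : smooth_on U f -> smooth_on U (pd i f).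
Proof. by move=> sf s u Uu; have := sf (rcons s i) u Uu; rewrite foldr_rcons. Qed.

Lemma smooth_on_diff U f u : smooth_on U f -> U u -> differentiable f u.
Proof. by move=> sf; apply: (sf [::]). Qed.

Lemma smooth_onP U f : smooth_on U f <-> forall k, Ck k U f.
Proof.
split=> [sf k|Ckf s u Uu].
  elim: k f sf => [|k IH] f sf /=; split=> //; try by move=> u; apply: smooth_on_diff.
  by move=> i; apply: IH; apply: smooth_on_pd.
elim/last_ind: s f Ckf => [|s i IH] f Ckf; first exact: (Ck_diff (Ckf 0%N)).
rewrite foldr_rcons; apply: IH => k; exact: Ck_pd (Ckf k.+1).
Qed.

Lemma near_of_open U (P : 'rV[R]_n -> Prop) u : open U -> U u ->
  (forall v, U v -> P v) -> \forall v \near u, P v.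
Proof.
move=> oU Uu UP; have : \forall v \near u, U v by apply: open_nbhs_nbhs; split.
by apply: filterS.
Qed.

Context (U : set 'rV[R]_n) (oU : open U).

Lemma pd_eq_on f g i u : (forall v, U v -> f v = g v) -> U u ->
  pd i f u = pd i g u.
Proof. by move=> fg Uu; apply: pd_near; apply: (near_of_open oU). Qed.

Lemma differentiable_eq_on f g u : (forall v, U v -> f v = g v) -> U u ->
  differentiable f u -> differentiable g u.
Proof. by move=> fg Uu; apply: differentiable_near; apply: (near_of_open oU). Qed.

Lemma Ck_eq_on k f g : (forall v, U v -> f v = g v) -> Ck k U f -> Ck k U g.
Proof.
elim: k f g => [|k IH] f g fg [df dk] /=; split=> //;
  try by move=> u Uu; apply: (differentiable_eq_on fg Uu); apply: df.
move=> i; apply: IH (dk i) => v Uv; exact: pd_eq_on.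
Qed.

Lemma Ck_cst k (c : R) : Ck k U (fun=> c).
Proof.
elim: k c => [|k IH] c /=; split=> //; try by move=> u _; apply: differentiable_cst.
by move=> i; apply: (Ck_eq_on _ (IH 0)) => v _; rewrite pd_cst.
Qed.

Lemma CkD k f g : Ck k U f -> Ck k U g -> Ck k U (fun v => f v + g v).
Proof.
elim: k f g => [|k IH] f g Cf Cg.
  by split=> // u Uu; apply: differentiableD; [apply: (Ck_diff Cf)|apply: (Ck_diff Cg)].
split=> [u Uu|i].
  by apply: differentiableD; [apply: (Ck_diff Cf)|apply: (Ck_diff Cg)].
apply: (Ck_eq_on _ (IH _ _ (Ck_pd i Cf) (Ck_pd i Cg))) => v Uv.
by rewrite pdD //; [apply: (Ck_diff Cf)|apply: (Ck_diff Cg)].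
Qed.

Lemma CkM k f g : Ck k U f -> Ck k U g -> Ck k U (fun v => f v * g v).
Proof.
elim: k f g => [|k IH] f g Cf Cg.
  by split=> // u Uu; apply: differentiableM; [apply: (Ck_diff Cf)|apply: (Ck_diff Cg)].
split=> [u Uu|i].
  by apply: differentiableM; [apply: (Ck_diff Cf)|apply: (Ck_diff Cg)].
apply: (Ck_eq_on _ (CkD (IH _ _ (Ck_pd i Cf) (CkS Cg)) (IH _ _ (CkS Cf) (Ck_pd i Cg)))) => v Uv.
by rewrite pdM //; [apply: (Ck_diff Cf)|apply: (Ck_diff Cg)].
Qed.

Lemma CkN k f : Ck k U f -> Ck k U (fun v => - f v).
Proof.
move=> Cf; apply: (Ck_eq_on _ (CkM (Ck_cst k (-1)) Cf)) => v _.
by rewrite mulN1r.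
Qed.

Lemma CkV k f : (forall v, U v -> f v != 0) -> Ck k U f ->
  Ck k U (fun v => (f v)^-1).
Proof.
move=> f0; have dV m : Ck m U f -> forall u, U u ->
  differentiable (fun v => (f v)^-1) u.
  by move=> Cf u Uu; apply: differentiableV; [apply: (Ck_diff Cf)|apply: f0].
elim: k => [|k IH] Cf; split; try exact: dV Cf; first by [].
move=> i; have CV := IH (CkS Cf).
apply: (Ck_eq_on _ (CkN (CkM (CkM (Ck_pd i Cf) CV) CV))) => v Uv.
by rewrite pdV ?f0 //; apply: (Ck_diff Cf).
Qed.

Lemma Ck_sqrt k f : (forall v, U v -> 0 < f v) -> Ck k U f ->
  Ck k U (fun v => Num.sqrt (f v)).
Proof.
move=> f0; have dV m : Ck m U f -> forall u, U u ->
  differentiable (fun v => Num.sqrt (f v)) u.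
  by move=> Cf u Uu; apply: differentiable_sqrt; [apply: f0|apply: (Ck_diff Cf)].
elim: k => [|k IH] Cf; split; try exact: dV Cf; first by [].
move=> i; have CV := IH (CkS Cf).
have s0 v : U v -> Num.sqrt (f v) != 0 by move=> /f0 ?; rewrite gt_eqF // sqrtr_gt0.
apply: (Ck_eq_on _ (CkM (CkM (Ck_pd i Cf) (Ck_cst k 2^-1)) (CkV s0 CV))) => v Uv.
by rewrite pd_sqrt ?f0 //; apply: (Ck_diff Cf).
Qed.

Lemma Ck_sum k (I : Type) (r : seq I) (F : I -> 'rV[R]_n -> R) :
  (forall a, Ck k U (F a)) -> Ck k U (fun v => \sum_(a <- r) F a v).
Proof.
move=> CF; elim: r => [|a r IH].
  by apply: (Ck_eq_on _ (Ck_cst k 0)) => v _; rewrite big_nil.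
by apply: (Ck_eq_on _ (CkD (CF a) IH)) => v _; rewrite big_cons.
Qed.

Lemma smooth_on_cst (c : R) : smooth_on U (fun=> c).
Proof. by apply/smooth_onP => k; apply: Ck_cst. Qed.

Lemma smooth_on_eq f g : (forall v, U v -> f v = g v) ->
  smooth_on U f -> smooth_on U g.
Proof. by move=> fg /smooth_onP sf; apply/smooth_onP => k; apply: Ck_eq_on (sf k). Qed.

Lemma smooth_onD f g : smooth_on U f -> smooth_on U g ->
  smooth_on U (fun v => f v + g v).
Proof. by move=> /smooth_onP sf /smooth_onP sg; apply/smooth_onP => k; apply: CkD. Qed.

Lemma smooth_onM f g : smooth_on U f -> smooth_on U g ->
  smooth_on U (fun v => f v * g v).
Proof. by move=> /smooth_onP sf /smooth_onP sg; apply/smooth_onP => k; apply: CkM. Qed.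

Lemma smooth_onN f : smooth_on U f -> smooth_on U (fun v => - f v).
Proof. by move=> /smooth_onP sf; apply/smooth_onP => k; apply: CkN. Qed.

Lemma smooth_onB f g : smooth_on U f -> smooth_on U g ->
  smooth_on U (fun v => f v - g v).
Proof. by move=> sf sg; apply: smooth_onD => //; apply: smooth_onN. Qed.

Lemma smooth_onV f : (forall v, U v -> f v != 0) -> smooth_on U f ->
  smooth_on U (fun v => (f v)^-1).
Proof. by move=> f0 /smooth_onP sf; apply/smooth_onP => k; apply: CkV. Qed.

Lemma smooth_on_sqrt f : (forall v, U v -> 0 < f v) -> smooth_on U f ->
  smooth_on U (fun v => Num.sqrt (f v)).
Proof. by move=> f0 /smooth_onP sf; apply/smooth_onP => k; apply: Ck_sqrt. Qed.

Lemma smooth_on_sum (I : Type) (r : seq I) (F : I -> 'rV[R]_n -> R) :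
  (forall a, smooth_on U (F a)) -> smooth_on U (fun v => \sum_(a <- r) F a v).
Proof.
by move=> sF; apply/smooth_onP => k; apply: Ck_sum => a; move: k; apply/smooth_onP.
Qed.

Lemma smooth_on_prod (I : Type) (r : seq I) (F : I -> 'rV[R]_n -> R) :
  (forall a, smooth_on U (F a)) -> smooth_on U (fun v => \prod_(a <- r) F a v).
Proof.
move=> sF; elim: r => [|a r IH].
  by apply: (smooth_on_eq _ (smooth_on_cst 1)) => v _; rewrite big_nil.
by apply: (smooth_on_eq _ (smooth_onM (sF a) IH)) => v _; rewrite big_cons.
Qed.

End Smoothness.

Lemma smooth_on_sub (R : realType) (n : nat) (U V : set 'rV[R]_n) f :
  U `<=` V -> smooth_on V f -> smooth_on U f.
Proof. by move=> UV sf s u /UV; apply: sf. Qed.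

(** By the chain rule the derivative of q o f is a sum of products of
    derivatives of f with composites (d_a q) o f, to which induction applies. *)
Lemma Ck_comp (R : realType) (m n : nat) (U : set 'rV[R]_m) (V : set 'rV[R]_n)
    (k : nat) (q : 'rV[R]_n -> R) (f : 'rV[R]_m -> 'rV[R]_n) :
  open U -> (forall u, U u -> V (f u)) ->
  (forall a, Ck k U (fun u => f u 0 a)) -> Ck k V q -> Ck k U (fun u => q (f u)).
Proof.
move=> oU fUV; have dq l q' : (forall a, Ck l U (fun u => f u 0 a)) -> Ck l V q' ->
    forall u, U u -> differentiable (fun u => q' (f u)) u.
  move=> Cf Cq u Uu; apply: differentiable_comp_row => [a|].
    exact: Ck_diff (Cf a) _ Uu.
  exact: Ck_diff Cq _ (fUV _ Uu).
elim: k q => [|k IH] q Cf Cq; split; try exact: dq; first by [].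
move=> i; have Cs a := IH (pd a q) (fun a => CkS (Cf a)) (Ck_pd a Cq).
apply: (Ck_eq_on oU _ (Ck_sum oU (index_enum 'I_n)
  (fun a => CkM oU (Cs a) (Ck_pd i (Cf a))))) => v Uv.
rewrite pd_comp //; first by move=> a; apply: Ck_diff (Cf a) _ Uv.
exact: Ck_diff Cq _ (fUV _ Uv).
Qed.

Lemma smooth_on_comp (R : realType) (m n : nat) (U : set 'rV[R]_m)
    (V : set 'rV[R]_n) (q : 'rV[R]_n -> R) (f : 'rV[R]_m -> 'rV[R]_n) :
  open U -> (forall u, U u -> V (f u)) ->
  (forall a, smooth_on U (fun u => f u 0 a)) -> smooth_on V q ->
  smooth_on U (fun u => q (f u)).
Proof.
move=> oU fUV sf /smooth_onP sq; apply/smooth_onP => k.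
by apply: (Ck_comp oU fUV) => // a; move: k; apply/smooth_onP.
Qed.

Lemma pd_coord (R : realType) (n : nat) (i a : 'I_n) (u : 'rV[R]_n) :
  pd i (fun v : 'rV[R]_n => v 0 a) u = ('e_i : 'rV[R]_n) 0 a.
Proof.
have := @derive_mx R _ 1 n id u 'e_i (@derivable_id _ _ u 'e_i).
by rewrite derive_id => /matrixP/(_ 0 a) ->; rewrite mxE.
Qed.

Lemma smooth_on_coord (R : realType) (n : nat) (U : set 'rV[R]_n) (a : 'I_n) :
  open U -> smooth_on U (fun u : 'rV[R]_n => u 0 a).
Proof.
move=> oU; apply/smooth_onP => -[|k]; split=> //;
  try by move=> u _; apply: differentiable_coord.
move=> i; apply: (Ck_eq_on oU _ (Ck_cst oU k (('e_i : 'rV[R]_n) 0 a))) => v _.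
by rewrite pd_coord.
Qed.

Lemma smooth_on_det (R : realType) (m n : nat) (U : set 'rV[R]_m)
    (A : 'rV[R]_m -> 'M[R]_n) :
  open U -> (forall i j, smooth_on U (fun u => A u i j)) ->
  smooth_on U (fun u => \det (A u)).
Proof.
move=> oU sA; rewrite /determinant; apply: smooth_on_sum => // s.
apply: smooth_onM => //; first exact: smooth_on_cst.
exact: smooth_on_prod.
Qed.

(** Cramer's rule: the entries are cofactors divided by the determinant. *)
Lemma smooth_on_invmx (R : realType) (m n : nat) (U : set 'rV[R]_m)
    (A : 'rV[R]_m -> 'M[R]_n) i j :
  open U -> (forall u, U u -> A u \in unitmx) ->
  (forall i j, smooth_on U (fun u => A u i j)) ->
  smooth_on U (fun u => invmx (A u) i j).
Proof.
move=> oU uA sA.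
have E v : U v -> (\det (A v))^-1 * cofactor (A v) j i = invmx (A v) i j.
  by move=> Uv; rewrite /invmx uA // !mxE.
apply: (smooth_on_eq oU E); apply: smooth_onM => //.
  apply: smooth_onV => //; last exact: smooth_on_det.
  by move=> v Uv; have := uA v Uv; rewrite unitmxE unitfE.
rewrite /cofactor; apply: smooth_onM => //; first exact: smooth_on_cst.
apply: smooth_on_det => // a b.
by apply: (smooth_on_eq oU _ (sA (lift j a) (lift i b))) => v _; rewrite !mxE.
Qed.

(** * Symmetry of second derivatives *)

Lemma is_derive_line (R : realType) (n : nat) (f : 'rV[R]_n -> R)
    (v b : 'rV[R]_n) (s : R) :
  derivable f (s *: v + b) v ->
  is_derive s 1 (fun t => f (t *: v + b)) ('D_v f (s *: v + b)).
Proof.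
have E : (fun h => h^-1 *: (f ((h *: (1 : R) + s) *: v + b) - f (s *: v + b)))
  = (fun h => h^-1 *: (f (h *: v + (s *: v + b)) - f (s *: v + b))).
  by apply/funext => h; rewrite [h *: 1]mulr1 scalerDl addrA.
by move=> df; apply: DeriveDef; rewrite /derivable /derive E.
Qed.

(** The second difference of f over the square with sides t e_i and t e_j is
    t^2 d_j d_i f + o(t^2).  By the mean value theorem in direction e_i it is t
    times an increment of d_i f in direction e_j, which the differentiability
    of d_i f at u estimates. *)
Lemma second_difference (R : realType) (n : nat) (U : set 'rV[R]_n)
    (f : 'rV[R]_n -> R) (i j : 'I_n) u :
  open U -> U u -> (forall v, U v -> differentiable f v) ->
  differentiable (pd i f) u ->
  forall e : R, 0 < e -> \forall t \near 0^'+,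
    `|f (t *: 'e_i + (t *: 'e_j + u)) - f (t *: 'e_i + u) - f (t *: 'e_j + u) + f u
      - t ^+ 2 * pd j (pd i f) u| <= e * t ^+ 2.
Proof.
move=> oU Uu df dp e e0.
set a := `|'e_i : 'rV[R]_n|; set b := `|'e_j : 'rV[R]_n|.
have a0 : 0 <= a by exact: normr_ge0.
have b0 : 0 <= b by exact: normr_ge0.
(* The two increments of d_i f cost at most e / K * t * (a + b) each. *)
set K := 2 * (a + b) + 1; have K0 : 0 < K by rewrite /K; lra.
have eK0 : 0 < e / K by rewrite divr_gt0.
have [dpc dpE] := (diff_locallyP _ _).1 dp.
have /nbhs_ballP[d1 /= d10 D1] : \forall h \near (0 : 'rV[R]_n),
    U (h + u) /\ `|pd i f (h + u) - (pd i f u + 'd (pd i f) u h)| <= e / K * `|h|.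
  apply: filterI.
    have : \forall v \near u, U v by apply: open_nbhs_nbhs.
    by rewrite (near_shift 0 u); apply: filterS => x; rewrite /= subr0.
  by have /eqaddoP/(_ _ eK0) := dpE; apply: filterS => h.
near=> t.
have t0 : 0 < t by near: t; exact: nbhs_right_gt.
have tK : t * K < d1.
  by rewrite -ltr_pdivlMr //; near: t; apply: nbhs_right_lt; rewrite divr_gt0.
have bnd s : 0 <= s <= t -> forall x, 0 <= x <= t ->
   `|s *: 'e_i + x *: 'e_j : 'rV[R]_n| <= t * (a + b).
  move=> /andP[s0 st] x /andP[x0 xt]; rewrite (le_trans (ler_normD _ _)) // !normrZ.
  by rewrite !ger0_norm // mulrDr lerD // ler_wpM2r.
have inU s : 0 <= s <= t -> forall x, 0 <= x <= t ->
    U (s *: 'e_i + (x *: 'e_j + u)) /\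
    `|pd i f (s *: 'e_i + (x *: 'e_j + u)) -
      (pd i f u + (s * pd i (pd i f) u + x * pd j (pd i f) u))| <= e / K * (t * (a
        + b)).
  move=> st x xt; have B := bnd s st x xt.
  have [] := D1 (s *: 'e_i + x *: 'e_j).
    rewrite -ball_normE /= sub0r normrN (le_lt_trans B) // (le_lt_trans _ tK) //.
    by rewrite ler_pM2l // /K; lra.
  have -> : 'd (pd i f) u (s *: 'e_i + x *: 'e_j) = s * pd i (pd i f) u
    + x * pd j (pd i f) u.
    rewrite (linearD ('d (pd i f) u)) /pd !(deriveE _ dp).
    by congr (_ + _); exact: linearZ.
  rewrite -addrA => ? P; split=> //.
  by apply: le_trans P _; rewrite ler_pM2l.
have tt : 0 <= t <= t by apply/andP; split; rewrite ?lexx ?ltW.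
have t00 : 0 <= (0 : R) <= t by apply/andP; split; rewrite ?lexx ?ltW.
pose phi s := f (s *: 'e_i + (t *: 'e_j + u)) - f (s *: 'e_i + u).
pose dphi s := pd i f (s *: 'e_i + (t *: 'e_j + u)) - pd i f (s *: 'e_i + u).
have phiD s : 0 <= s <= t -> is_derive s 1 phi (dphi s).
  move=> st; have [U1 _] := inU s st t tt; have [U2 _] := inU s st 0 t00.
  rewrite scale0r add0r in U2.
  apply: is_deriveB; apply: is_derive_line; apply: diff_derivable; exact: df.
have [c|c0t|c /andP[/= c0 ct]] := @MVT R phi dphi 0 t t0 _ _.
- by rewrite in_itv /= => /andP[? ?]; apply: phiD; rewrite !ltW.
- apply: derivable_within_continuous => s; rewrite in_itv /= => st.
  by have [] := phiD s st.
rewrite /phi /dphi scale0r !add0r subr0 => E.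
have ct' : 0 <= c <= t by rewrite !ltW.
have [_ E1] := inU c ct' t tt; have [_ E2] := inU c ct' 0 t00.
rewrite scale0r add0r mul0r addr0 in E2.
set p1 := pd i f (c *: 'e_i + (t *: 'e_j + u)) in E E1.
set p2 := pd i f (c *: 'e_i + u) in E E2.
set q := pd j (pd i f) u in E1 *.
have -> : f (t *: 'e_i + (t *: 'e_j + u)) - f (t *: 'e_i + u) - f (t *: 'e_j + u) + f u
   - t ^+ 2 * q = t * (p1 - p2 - t * q).
  have -> : t * (p1 - p2 - t * q) = (p1 - p2) * t - t ^+ 2 * q by ring.
  by rewrite -E; ring.
rewrite normrM (gtr0_norm t0) expr2 mulrCA ler_pM2l //.
have -> : p1 - p2 - t * q = (p1 - (pd i f u + (c * pd i (pd i f) u + t * q)))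
    - (p2 - (pd i f u + c * pd i (pd i f) u)) by ring.
apply: (le_trans (ler_normB _ _)); apply: (le_trans (lerD E1 E2)).
have -> : e / K * (t * (a + b)) + e / K * (t * (a + b)) = e * t * ((2 * (a + b)) / K).
  by field; exact: lt0r_neq0.
rewrite ger_pMr ?mulr_gt0 // ler_pdivrMr // mul1r /K; lra.
Unshelve. all: by end_near. Qed.

(** The second difference is symmetric in i and j, so that its two
    expansions must agree. *)
Lemma pdC (R : realType) (n : nat) (U : set 'rV[R]_n)
    (f : 'rV[R]_n -> R) (i j : 'I_n) u :
  open U -> U u -> smooth_on U f -> pd i (pd j f) u = pd j (pd i f) u.
Proof.
move=> oU Uu sf.
have S k l := @second_difference R n U f k l u oU Uu
  (fun v => @smooth_on_diff _ _ _ _ v sf)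
  (smooth_on_diff (smooth_on_pd k sf) Uu).
apply/eqP; rewrite -subr_eq0 -normr_le0; apply/ler_addgt0Pl => e e0.
have e20 : 0 < e / 2 by rewrite divr_gt0.
have [t [t0 [S1 S2]]] := filter_ex
  (filterI (nbhs_right_gt (0 : R)) (filterI (S i j _ e20) (S j i _ e20))).
rewrite addr0 -(ler_pM2l (exprn_gt0 2 t0)) -[X in X * `|_|](gtr0_norm (exprn_gt0 2 t0)) -normrM.
move: S1 S2; rewrite addrCA; set x1 := f _; set x2 := f _; set x3 := f _; set x4 := f u.
set y1 := pd _ _ _; set y2 := pd _ _ _ => S1 S2.
have -> : t ^+ 2 * (y2 - y1) = (x1 - x2 - x3 + x4 - t ^+ 2 * y1) - (x1 - x3 - x2
  + x4 - t ^+ 2 * y2) by ring.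
apply: (le_trans (ler_normB _ _)); apply: (le_trans (lerD S1 S2)).
by rewrite -mulrDl -splitr mulrC.
Qed.

(** * The Levi-Civita connection along a map *)

(** Vector fields, metrics and connection forms are all matrices of functions,
    so that their differential calculus is that of [mpd], the entrywise partial
    derivative. *)
HB.lock Definition mpd (R : realType) (m p q : nat) (i : 'I_m)
    (A : 'rV[R]_m -> 'M[R]_(p, q)) (u : 'rV[R]_m) : 'M[R]_(p, q) :=
  \matrix_(a, b) pd i (fun v => A v a b) u.

Lemma mpdE (R : realType) (m p q : nat) (i : 'I_m)
    (A : 'rV[R]_m -> 'M[R]_(p, q)) u a b : mpd i A u a b = pd i (fun v => A v a b) u.
Proof. by rewrite mpd.unlock mxE. Qed.

Definition mdiff (R : realType) (m p q : nat)
    (A : 'rV[R]_m -> 'M[R]_(p, q)) (u : 'rV[R]_m) : Prop :=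
  forall a b, differentiable (fun v => A v a b) u.

Definition msmooth (R : realType) (m p q : nat) (U : set 'rV[R]_m)
    (A : 'rV[R]_m -> 'M[R]_(p, q)) : Prop :=
  forall a b, smooth_on U (fun v => A v a b).

Section MatrixCalculus.
Context (R : realType) (m : nat).
Implicit Types (i j : 'I_m) (u : 'rV[R]_m) (U : set 'rV[R]_m).

Lemma msmooth_diff p q U (A : 'rV[R]_m -> 'M[R]_(p, q)) u :
  msmooth U A -> U u -> mdiff A u.
Proof. by move=> sA Uu a b; apply: smooth_on_diff (sA a b) Uu. Qed.

Lemma msmooth_pd p q U i (A : 'rV[R]_m -> 'M[R]_(p, q)) :
  msmooth U A -> msmooth U (mpd i A).
Proof.
move=> sA a b; have -> : (fun v => mpd i A v a b) = pd i (fun v => A v a b).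
  by apply/funext => v; rewrite mpdE.
exact: smooth_on_pd.
Qed.

Lemma mpd_eq_on p q U i (A B : 'rV[R]_m -> 'M[R]_(p, q)) u :
  open U -> (forall v, U v -> A v = B v) -> U u -> mpd i A u = mpd i B u.
Proof.
move=> oU AB Uu; apply/matrixP => a b; rewrite !mpdE.
by apply: (pd_eq_on oU) => // v Uv; rewrite AB.
Qed.

Lemma mpd_cst p q i (A : 'M[R]_(p, q)) u : mpd i (fun=> A) u = 0.
Proof. by apply/matrixP => a b; rewrite mpdE mxE; under eq_fun do rewrite /=;
  rewrite pd_cst. Qed.

Lemma mpdD p q i (A B : 'rV[R]_m -> 'M[R]_(p, q)) u : mdiff A u -> mdiff B u ->
  mpd i (fun v => A v + B v) u = mpd i A u + mpd i B u.
Proof.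
move=> dA dB; apply/matrixP => a b; rewrite mpdE [RHS]mxE !mpdE -pdD //.
by congr (pd i _ u); apply/funext => v; rewrite mxE.
Qed.

Lemma mpdM p q r i (A : 'rV[R]_m -> 'M[R]_(p, q))
    (B : 'rV[R]_m -> 'M[R]_(q, r)) u : mdiff A u -> mdiff B u ->
  mpd i (fun v => A v *m B v) u = mpd i A u *m B u + A u *m mpd i B u.
Proof.
move=> dA dB; apply/matrixP => a b; rewrite mpdE !mxE -big_split /=.
under [RHS]eq_bigr => c _ do rewrite !mpdE -pdM //.
rewrite -pd_sum; last by move=> c; apply: differentiableM.
by congr (pd i _ u); apply/funext => v; rewrite mxE.
Qed.

Lemma mpdZ p q i (s : 'rV[R]_m -> R) (A : 'rV[R]_m -> 'M[R]_(p, q)) u :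
  differentiable s u -> mdiff A u ->
  mpd i (fun v => s v *: A v) u = pd i s u *: A u + s u *: mpd i A u.
Proof.
move=> ds dA; apply/matrixP => a b; rewrite !(mpdE, mxE) -pdM //.
by congr (pd i _ u); apply/funext => v; rewrite mxE.
Qed.

Lemma mpd_sum p q i (I : Type) (r : seq I)
    (F : I -> 'rV[R]_m -> 'M[R]_(p, q)) u : (forall k, mdiff (F k) u) ->
  mpd i (fun v => \sum_(k <- r) F k v) u = \sum_(k <- r) mpd i (F k) u.
Proof.
move=> dF; apply/matrixP => a b; rewrite mpdE summxE.
under [RHS]eq_bigr => c _ do rewrite mpdE.
rewrite -pd_sum; last by move=> c; apply: dF.
by congr (pd i _ u); apply/funext => v; rewrite summxE.
Qed.

Lemma mpd_tr p q i (A : 'rV[R]_m -> 'M[R]_(p, q)) u :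
  mpd i (fun v => (A v)^T) u = (mpd i A u)^T.
Proof.
apply/matrixP => a b; rewrite !(mxE, mpdE).
by congr (pd i _ u); apply/funext => v; rewrite mxE.
Qed.

Lemma mpdC p q U i j (A : 'rV[R]_m -> 'M[R]_(p, q)) u :
  open U -> U u -> msmooth U A -> mpd i (mpd j A) u = mpd j (mpd i A) u.
Proof.
move=> oU Uu sA; apply/matrixP => a b.
have E k l : mpd k (mpd l A) u a b = pd k (pd l (fun v => A v a b)) u.
  by rewrite mpdE; congr (pd k _ u); apply/funext => v; exact: mpdE.
exact: etrans (E i j) (etrans (@pdC R m U (fun v => A v a b) i j u oU Uu (sA a b)) (esym (E j i))).
Qed.

Lemma msmooth_cst p q U (A : 'M[R]_(p, q)) : open U -> msmooth U (fun=> A).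
Proof. by move=> oU a b; apply: smooth_on_cst. Qed.

Lemma msmooth_eq p q U (A B : 'rV[R]_m -> 'M[R]_(p, q)) :
  open U -> (forall v, U v -> A v = B v) -> msmooth U A -> msmooth U B.
Proof.
by move=> oU AB sA a b; apply: (smooth_on_eq oU _ (sA a b)) => v /AB ->.
Qed.

Lemma msmoothD p q U (A B : 'rV[R]_m -> 'M[R]_(p, q)) :
  open U -> msmooth U A -> msmooth U B -> msmooth U (fun v => A v + B v).
Proof.
move=> oU sA sB a b.
by apply: (smooth_on_eq oU _ (smooth_onD oU (sA a b) (sB a b))) => v _; rewrite mxE.
Qed.

Lemma msmoothZ p q U (s : 'rV[R]_m -> R) (A : 'rV[R]_m -> 'M[R]_(p, q)) :
  open U -> smooth_on U s -> msmooth U A -> msmooth U (fun v => s v *: A v).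
Proof.
move=> oU ss sA a b.
by apply: (smooth_on_eq oU _ (smooth_onM oU ss (sA a b))) => v _; rewrite mxE.
Qed.

Lemma msmoothB p q U (A B : 'rV[R]_m -> 'M[R]_(p, q)) :
  open U -> msmooth U A -> msmooth U B -> msmooth U (fun v => A v - B v).
Proof.
move=> oU sA sB a b.
by apply: (smooth_on_eq oU _ (smooth_onB oU (sA a b) (sB a b))) => v _; rewrite !mxE.
Qed.

Lemma msmooth_sum p q U (I : Type) (r : seq I)
    (F : I -> 'rV[R]_m -> 'M[R]_(p, q)) :
  open U -> (forall k, msmooth U (F k)) -> msmooth U (fun v => \sum_(k <- r) F k v).
Proof.
move=> oU sF a b.
by apply: (smooth_on_eq oU _ (smooth_on_sum oU r (fun k => sF k a b))) => v _;
  rewrite summxE.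
Qed.

Lemma msmoothM p q r U (A : 'rV[R]_m -> 'M[R]_(p, q))
    (B : 'rV[R]_m -> 'M[R]_(q, r)) :
  open U -> msmooth U A -> msmooth U B -> msmooth U (fun v => A v *m B v).
Proof.
move=> oU sA sB a b.
apply: (smooth_on_eq oU _ (smooth_on_sum oU (index_enum 'I_q)
  (fun k => smooth_onM oU (sA a k) (sB k b)))) => v _.
by rewrite mxE.
Qed.

Lemma msmooth_tr p q U (A : 'rV[R]_m -> 'M[R]_(p, q)) :
  open U -> msmooth U A -> msmooth U (fun v => (A v)^T).
Proof.
by move=> oU sA a b; apply: (smooth_on_eq oU _ (sA b a)) => v _; rewrite mxE.
Qed.

Lemma msmooth_comp n p q U (V : set 'rV[R]_n) (A : 'rV[R]_n -> 'M[R]_(p, q))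
    (f : 'rV[R]_m -> 'rV[R]_n) :
  open U -> (forall u, U u -> V (f u)) -> msmooth U f -> msmooth V A ->
  msmooth U (fun u => A (f u)).
Proof. by move=> oU fUV sf sA a b; apply: smooth_on_comp oU fUV (sf 0) (sA a b). Qed.

Lemma mpd_comp n p q i (A : 'rV[R]_n -> 'M[R]_(p, q)) (f : 'rV[R]_m -> 'rV[R]_n) u :
  mdiff f u -> mdiff A (f u) ->
  mpd i (fun v => A (f v)) u = \sum_c jac f u i c *: mpd c A (f u).
Proof.
move=> df dA; apply/matrixP => a b; rewrite mpdE summxE.
rewrite (_ : pd i _ u = \sum_c pd c (fun q => A q a b) (f u) * pd i (fun v => f v 0 c) u).
  by apply: eq_bigr => c _; rewrite !(mxE, mpdE) mulrC.
exact: (@pd_comp _ _ _ i (fun q => A q a b) f u (df 0) (dA a b)).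
Qed.

Lemma msmooth_jac n U (f : 'rV[R]_m -> 'rV[R]_n) :
  msmooth U f -> msmooth U (jac f).
Proof.
move=> sf a b; have -> : (fun v => jac f v a b) = pd a (fun v => f v 0 b).
  by apply/funext => v; rewrite mxE.
exact: smooth_on_pd.
Qed.

End MatrixCalculus.

Definition metric_on (R : realType) (n : nat) (V : set 'rV[R]_n)
    (h : 'rV[R]_n -> 'M[R]_n) : Prop :=
  [/\ msmooth V h, forall p, V p -> (h p)^T = h p &
      forall p, V p -> forall v : 'rV[R]_n, v != 0 -> 0 < ip h p v v].

(** The matrix of X |-> nabla_{d_a} X on vector fields with constant
    components: row b holds the components of nabla_{d_a} d_b. *)
Definition conn (R : realType) (n : nat) (h : 'rV[R]_n -> 'M[R]_n)
    (a : 'I_n) (p : 'rV[R]_n) : 'M[R]_n :=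
  \matrix_(b, l) christoffel h p a b l.

(** The value on the i-th coordinate vector of the pull-back by f of the
    connection matrix, so that D_i X = d_i X + X A_i along f. *)
Definition cform (R : realType) (m n : nat) (h : 'rV[R]_n -> 'M[R]_n)
    (f : 'rV[R]_m -> 'rV[R]_n) (i : 'I_m) (u : 'rV[R]_m) : 'M[R]_n :=
  \sum_a jac f u i a *: conn h a (f u).

(** The matrix of Z |-> R(d_a, d_b) Z; the order of the factors is reversed as
    matrices act on the right. *)
Definition curv_mx (R : realType) (n : nat) (h : 'rV[R]_n -> 'M[R]_n)
    (a b : 'I_n) (p : 'rV[R]_n) : 'M[R]_n :=
  mpd a (conn h b) p - mpd b (conn h a) p
  + (conn h b p *m conn h a p - conn h a p *m conn h b p).

Section InnerProduct.
Context (R : realType) (n : nat) (h : 'rV[R]_n -> 'M[R]_n) (p : 'rV[R]_n).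
Implicit Types X Y : 'rV[R]_n.

Lemma ipDl X Y Z : ip h p (X + Y) Z = ip h p X Z + ip h p Y Z.
Proof. by rewrite /ip !mulmxDl mxE. Qed.
Lemma ipDr X Y Z : ip h p X (Y + Z) = ip h p X Y + ip h p X Z.
Proof. by rewrite /ip linearD mulmxDr mxE. Qed.
Lemma ipZl a X Y : ip h p (a *: X) Y = a * ip h p X Y.
Proof. by rewrite /ip -!scalemxAl mxE. Qed.
Lemma ipZr a X Y : ip h p X (a *: Y) = a * ip h p X Y.
Proof. by rewrite /ip linearZ -scalemxAr mxE. Qed.
Lemma ipNl X Y : ip h p (- X) Y = - ip h p X Y.
Proof. by rewrite -scaleN1r ipZl mulN1r. Qed.
Lemma ipNr X Y : ip h p X (- Y) = - ip h p X Y.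
Proof. by rewrite -scaleN1r ipZr mulN1r. Qed.
Lemma ip0l Y : ip h p 0 Y = 0.
Proof. by rewrite -(scale0r (0 : 'rV[R]_n)) ipZl mul0r. Qed.
Lemma ip0r Y : ip h p Y 0 = 0.
Proof. by rewrite -(scale0r (0 : 'rV[R]_n)) ipZr mul0r. Qed.
Lemma ipC X Y : (h p)^T = h p -> ip h p X Y = ip h p Y X.
Proof.
move=> hs; rewrite /ip; have -> : (Y *m h p *m X^T) 0 0 = (Y *m h p *m X^T)^T 0 0.
  by rewrite [RHS]mxE.
by rewrite !trmx_mul trmxK hs mulmxA.
Qed.
Lemma ip_suml I (r : seq I) (P : pred I) (F : I -> 'rV[R]_n) Y :
  ip h p (\sum_(k <- r | P k) F k) Y = \sum_(k <- r | P k) ip h p (F k) Y.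
Proof. by elim/big_rec2: _ => [|k x y _ <-]; rewrite ?ip0l ?ipDl. Qed.
Lemma ip_sumr I (r : seq I) (P : pred I) (F : I -> 'rV[R]_n) Y :
  ip h p Y (\sum_(k <- r | P k) F k) = \sum_(k <- r | P k) ip h p Y (F k).
Proof. by elim/big_rec2: _ => [|k x y _ <-]; rewrite ?ip0r ?ipDr. Qed.

End InnerProduct.

Section LeviCivita.
Context (R : realType) (n : nat) (V : set 'rV[R]_n) (h : 'rV[R]_n -> 'M[R]_n).
Hypotheses (oV : open V) (hV : metric_on V h).

(** A row of the kernel of h p would be a null vector of the metric. *)
Lemma metric_unit p : V p -> h p \in unitmx.
Proof.
move=> Vp; rewrite -row_free_unit; apply/row_freeP.
have [_ _ hp] := hV.
suff : row_free (h p) by move/row_freeP.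
rewrite -kermx_eq0; apply/eqP/row_matrixP => i; rewrite row0.
apply/eqP; apply: contraT => r0; have := hp p Vp _ r0.
by rewrite /ip -row_mul mulmx_ker row0 mul0mx mxE ltxx.
Qed.

Lemma pd_metricC c a b p : V p -> pd c (fun q => h q a b) p = pd c (fun q => h q b a) p.
Proof.
have [_ hs _] := hV; move=> Vp; apply: (pd_eq_on oV) => // q /hs E.
by rewrite -{1}E mxE.
Qed.

Lemma christoffelC a b l p : V p -> christoffel h p a b l = christoffel h p b a l.
Proof.
move=> Vp; rewrite /christoffel; congr (_ * _); apply: eq_bigr => s _.
congr (_ * _); congr (_ - _); last exact: pd_metricC.
exact: addrC.
Qed.

Lemma christoffel_lower a b k p : V p ->
  (conn h a p *m h p) b k = 2^-1 * (pd a (fun q => h q b k) p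
    + pd b (fun q => h q a k) p - pd k (fun q => h q a b) p).
Proof.
move=> Vp; have [_ hs _] := hV.
pose w : 'cV[R]_n := \col_s (pd a (fun q => h q b s) p + pd b (fun q => h q a s) p
     - pd s (fun q => h q a b) p).
have E l : conn h a p b l = 2^-1 * (invmx (h p) *m w) l 0.
  by rewrite !mxE; congr (_ * _); apply: eq_bigr => s _; rewrite mxE.
rewrite mxE; under eq_bigr => l _ do rewrite E -mulrA.
rewrite -mulr_sumr; congr (_ * _).
have -> : \sum_l (invmx (h p) *m w) l 0 * h p l k = (h p *m (invmx (h p) *m w)) k 0.
  rewrite [RHS]mxE; apply: eq_bigr => l _; rewrite mulrC; congr (_ * _).
  by rewrite -{1}hs // mxE.
by rewrite mulmxA mulmxV ?metric_unit // mul1mx mxE.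
Qed.

(** The Levi-Civita connection is metric: adding the Koszul formula to its
    transpose cancels the two antisymmetric derivatives. *)
Lemma conn_compat a p : V p ->
  mpd a h p = conn h a p *m h p + (conn h a p *m h p)^T.
Proof.
move=> Vp; apply/matrixP => b k;
  rewrite mpdE [RHS]mxE [X in _ + X]mxE !christoffel_lower //.
rewrite (pd_metricC a k b) //.
by set x := pd _ _ _; set y := pd _ _ _; set z := pd _ _ _; field.
Qed.

Lemma conn_smooth a : msmooth V (conn h a).
Proof.
move=> b l; have [hs _ _] := hV.
have sp i j k : smooth_on V (pd i (fun q => h q j k)) by apply: smooth_on_pd.
apply: (smooth_on_eq oV _ (smooth_onM oV (smooth_on_cst oV 2^-1)
  (smooth_on_sum oV (index_enum 'I_n) (fun s => smooth_onM oV
    (smooth_on_invmx l s oV metric_unit hs)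
    (smooth_onB oV (smooth_onD oV (sp a b s) (sp b a s)) (sp s a b)))))) => v Vv.
by rewrite mxE.
Qed.

End LeviCivita.

Section AlongMap.
Context (R : realType) (m n : nat) (U : set 'rV[R]_m) (V : set 'rV[R]_n).
Context (h : 'rV[R]_n -> 'M[R]_n) (f : 'rV[R]_m -> 'rV[R]_n).
Hypotheses (oU : open U) (oV : open V) (hV : metric_on V h).
Hypotheses (fUV : forall u, U u -> V (f u)) (sf : msmooth U f).
Implicit Types (X Y : 'rV[R]_m -> 'rV[R]_n) (i j : 'I_m) (u : 'rV[R]_m).

Lemma covDE i X u : covD h f i X u = mpd i X u + X u *m cform h f i u.
Proof.
apply/rowP => l; rewrite mxE [RHS]mxE; congr (_ + _); first by rewrite mpdE.
rewrite /cform mulmx_sumr summxE; apply: eq_bigr => a _.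
rewrite -scalemxAr [RHS]mxE [X in _ * X]mxE mulr_sumr; apply: eq_bigr => b _.
rewrite [conn _ _ _ _ _]mxE.
by ring.
Qed.

Lemma cform_smooth i : msmooth U (cform h f i).
Proof.
apply: msmooth_sum => // a; apply: msmoothZ => //; first exact: msmooth_jac.
exact: msmooth_comp oU fUV sf (conn_smooth oV hV a).
Qed.

Lemma covD_smooth i X : msmooth U X -> msmooth U (covD h f i X).
Proof.
move=> sX; apply: (msmooth_eq oU (fun v _ => esym (covDE i X v))).
apply: msmoothD => //; first exact: msmooth_pd.
by apply: msmoothM => //; exact: cform_smooth.
Qed.

Lemma covD_eq_on i X Y u : (forall v, U v -> X v = Y v) -> U u ->
  covD h f i X u = covD h f i Y u.
Proof. by move=> XY Uu; rewrite !covDE (XY _ Uu) (mpd_eq_on _ oU XY Uu). Qed.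

Lemma covDZ i (c : R) X u : mdiff X u ->
  covD h f i (fun v => c *: X v) u = c *: covD h f i X u.
Proof.
move=> dX; by rewrite !covDE mpdZ // pd_cst scale0r add0r -scalemxAl scalerDr.
Qed.

Lemma metric_along_smooth : msmooth U (fun v => h (f v)).
Proof. by have [hs _ _] := hV; apply: msmooth_comp oU fUV sf hs. Qed.

Lemma ip_smooth X Y : msmooth U X -> msmooth U Y ->
  smooth_on U (fun v => ip h (f v) (X v) (Y v)).
Proof.
move=> sX sY; rewrite /ip; apply: (msmoothM oU _ (msmooth_tr oU sY)).
exact: (msmoothM oU sX metric_along_smooth).
Qed.

(** The pulled-back connection is metric because the derivative of h o f in
    direction i is the contraction of dh with the i-th row of the Jacobian, to
    which [conn_compat] applies. *)
Lemma pd_ip i X Y u : U u -> mdiff X u -> mdiff Y u ->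
  pd i (fun v => ip h (f v) (X v) (Y v)) u
  = ip h (f u) (covD h f i X u) (Y u) + ip h (f u) (X u) (covD h f i Y u).
Proof.
move=> Uu dX dY; have Vu := fUV Uu; have [hs hsym _] := hV.
have dh : mdiff (fun v => h (f v)) u by apply: msmooth_diff metric_along_smooth Uu.
have dXh : mdiff (fun v => X v *m h (f v)) u.
  by move=> a b; under eq_fun do rewrite mxE; apply: differentiable_sum_seq => c;
    apply: differentiableM.
have dYt : mdiff (fun v => (Y v)^T) u.
  by move=> a b; under eq_fun do rewrite mxE; apply: dY.
have -> : pd i (fun v => ip h (f v) (X v) (Y v)) u
  = mpd i (fun v => X v *m h (f v) *m (Y v)^T) u 0 0 by rewrite mpdE.
rewrite mpdM // mpdM // mpd_tr (@mpd_comp R m n n n i h f u) //; first last.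
- exact: msmooth_diff hs Vu.
- exact: msmooth_diff sf Uu.
set A := cform h f i u.
have -> : \sum_c jac f u i c *: mpd c h (f u) = A *m h (f u) + h (f u) *m A^T.
  rewrite -[X in _ + X *m _](hsym _ Vu) -trmx_mul /A /cform !mulmx_suml linear_sum -big_split /=.
  apply: eq_bigr => c _; rewrite (conn_compat oV hV c Vu) scalerDr -!scalemxAl.
  by rewrite linearZ.
rewrite !covDE -/A /ip.
transitivity (((mpd i X u + X u *m A) *m h (f u) *m (Y u)^T
  + X u *m h (f u) *m (mpd i Y u + Y u *m A)^T) 0 0); last by rewrite mxE.
congr (fun_of_matrix _ 0 0).
rewrite [(_ + _)^T]linearD /= trmx_mul !(mulmxDl, mulmxDr) !mulmxA.
set a := mpd i X u *m _ *m _; set b := X u *m A *m _ *m _; set c := _ *m A^T *m _.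
set d := _ *m (mpd i Y u)^T.
by rewrite -!addrA; congr (_ + (_ + _)); rewrite addrC.
Qed.

(** The derivatives of X cancel: the commutator of two covariant derivatives
    is the curvature dA + A ^ A of the connection form applied to X. *)
Lemma covD_comm i j X u : U u -> msmooth U X ->
  covD h f i (covD h f j X) u - covD h f j (covD h f i X) u
  = X u *m (mpd i (cform h f j) u - mpd j (cform h f i) u
     + (cform h f j u *m cform h f i u - cform h f i u *m cform h f j u)).
Proof.
move=> Uu sX.
have dX := msmooth_diff sX Uu.
have dpX k := msmooth_diff (msmooth_pd k sX) Uu.
have dc k := msmooth_diff (cform_smooth k) Uu.
have dXc k : mdiff (fun v => X v *m cform h f k v) u.
  exact: msmooth_diff (msmoothM oU sX (cform_smooth k)) Uu.
have E k l : covD h f k (covD h f l X) u = mpd k (mpd l X) u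
  + (mpd k X u *m cform h f l u
   + X u *m mpd k (cform h f l) u) + (mpd l X u
     + X u *m cform h f l u) *m cform h f k u.
  rewrite covDE; have -> : covD h f l X = (fun v => mpd l X v + X v *m cform h f l v).
    by apply/funext => v; apply: covDE.
  by rewrite mpdD // mpdM.
rewrite !E (mpdC i j oU Uu sX) !(mulmxDr, mulmxDl, mulmxN, mulmxA) ?opprD.
set a := mpd j (mpd i X) u.
set t1 := mpd i X u *m _; set t2 := mpd j X u *m _; set t3 := X u *m mpd i _ _.
set t4 := X u *m mpd j _ _; set t5 := X u *m _ *m _; set t6 := X u *m _ *m _.
by clearbody a t1 t2 t3 t4 t5 t6; apply/rowP => l; rewrite !mxE; ring.
Qed.

Lemma mpd_cform i j u : U u ->
  mpd i (cform h f j) u = \sum_a (pd i (fun v => jac f v j a) u *: conn h a (f u)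
    + \sum_c (jac f u j a * jac f u i c) *: mpd c (conn h a) (f u)).
Proof.
move=> Uu; have sj := msmooth_jac sf.
have sc a := msmooth_comp oU fUV sf (conn_smooth oV hV a).
rewrite /cform mpd_sum; last first.
  by move=> a; apply: msmooth_diff (msmoothZ oU (sj j a) (sc a)) Uu.
apply: eq_bigr => a _; rewrite mpdZ; first last.
- exact: msmooth_diff (sc a) Uu.
- exact: smooth_on_diff (sj j a) Uu.
congr (_ + _); rewrite (@mpd_comp R m n n n i (conn h a) f u); first last.
- exact: msmooth_diff (conn_smooth oV hV a) (fUV Uu).
- exact: msmooth_diff sf Uu.
by rewrite scaler_sumr; apply: eq_bigr => c _; rewrite scalerA.
Qed.

(** The second derivatives of f cancel in the curvature of the pulled-back
    connection form, which is therefore the pull-back of the curvature. *)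
Lemma cform_curv i j u : U u ->
  mpd i (cform h f j) u - mpd j (cform h f i) u
     + (cform h f j u *m cform h f i u - cform h f i u *m cform h f j u)
  = \sum_a \sum_b (jac f u i a * jac f u j b) *: curv_mx h a b (f u).
Proof.
move=> Uu; rewrite !mpd_cform // !big_split /=.
have -> : \sum_a pd i (fun v => jac f v j a) u *: conn h a (f u)
        = \sum_a pd j (fun v => jac f v i a) u *: conn h a (f u).
  apply: eq_bigr => a _; congr (_ *: _).
  have E k : (fun v => jac f v k a) = pd k (fun v => f v 0 a).
    by apply/funext => v; rewrite mxE.
  by rewrite (E j) (E i); apply: pdC oU Uu (sf 0 a).
have cancel (x y z : 'M[R]_n) : (x + y) - (x + z) = y - z.
  by rewrite opprD addrACA subrr add0r.
rewrite cancel.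
have F k l : cform h f k u *m cform h f l u
    = \sum_a \sum_b (jac f u k a * jac f u l b) *: (conn h a (f u) *m conn h b (f u)).
  rewrite /cform mulmx_suml; apply: eq_bigr => a _; rewrite mulmx_sumr.
  by apply: eq_bigr => b _; rewrite -scalemxAl -scalemxAr scalerA.
rewrite !F.
have -> : \sum_a \sum_c (jac f u j a * jac f u i c) *: mpd c (conn h a) (f u)
  = \sum_a \sum_b (jac f u i a * jac f u j b) *: mpd a (conn h b) (f u).
  rewrite exchange_big /=; apply: eq_bigr => a _; apply: eq_bigr => b _.
  by congr (_ *: _); exact: mulrC.
have -> : \sum_a \sum_b (jac f u j a * jac f u i b) *: (conn h a (f u) *m conn h b (f u))
  = \sum_a \sum_b (jac f u i a * jac f u j b) *: (conn h b (f u) *m conn h a (f u)).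
  rewrite exchange_big /=; apply: eq_bigr => a _; apply: eq_bigr => b _.
  by congr (_ *: _); exact: mulrC.
rewrite -!sumrB -big_split /=; apply: eq_bigr => a _.
rewrite -!sumrB -big_split /=; apply: eq_bigr => b _.
by rewrite -!scalerBr -scalerDr.
Qed.

Lemma torsion_free i j u : U u ->
  covD h f i (fun q => dmap f q 'e_j) u = covD h f j (fun q => dmap f q 'e_i) u.
Proof.
move=> Uu; apply/rowP => l; rewrite !mxE.
have E k : (fun q => dmap f q 'e_k 0 l) = pd k (fun v => f v 0 l).
  by apply/funext => v; rewrite /dmap -rowE !mxE.
rewrite (E j) (E i) (pdC i j oU Uu (sf 0 l)); congr (_ + _).
rewrite exchange_big /=; apply: eq_bigr => a _; apply: eq_bigr => b _.
rewrite (christoffelC oV hV _ _ _ (fUV Uu)).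
have dmapE k c : dmap f u 'e_k 0 c = jac f u k c by rewrite /dmap -rowE mxE.
by rewrite !dmapE mulrAC.
Qed.

End AlongMap.

(** * Symmetries of the curvature tensor *)

Section KahlerAlgebra.
Context (R : realFieldType) (E : zmodType) (J : E -> E) (D : E -> E -> E -> E -> R).
Hypotheses (JJ : forall X, J (J X) = - X) (JD : {morph J : X Y / X + Y}).
Hypothesis DD : forall X X' Y Z W, D (X + X') Y Z W = D X Y Z W + D X' Y Z W.
Hypothesis D12 : forall X Y Z W, D Y X Z W = - D X Y Z W.
Hypothesis D34 : forall X Y Z W, D X Y W Z = - D X Y Z W.
Hypothesis DB : forall X Y Z W, D X Y Z W + D Y Z X W + D Z X Y W = 0.

(** The four cyclic identities on the faces of an octahedron, added up. *)
Lemma curv_pair_sym X Y Z W : D X Y Z W = D Z W X Y.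
Proof.
have := DB X Y Z W; have := DB Y Z W X; have := DB Z W X Y; have := DB W X Y Z.
have := D34 Y Z X W; have := D34 Z W X Y; have := D34 X Y Z W; have := D34 X Z Y W.
have := D12 X Z Y W; have := D34 W X Y Z; have := D12 Y W X Z; have := D34 W Y X Z.
lra.
Qed.

Hypothesis DJ : forall X Y Z W, D X Y (J Z) (J W) = D X Y Z W.
Hypothesis Dhol : forall X, D X (J X) (J X) X = 0.

(** A curvature tensor with the symmetries of a Kaehler curvature tensor is
    determined by its holomorphic sectional curvatures: polarisation and the
    Bianchi identity first kill all sectional curvatures, then the tensor. *)
Lemma kahler_curv_eq0 X Y Z W : D X Y Z W = 0.
Proof.
have sym := curv_pair_sym.
have DDr A B B' C F : D A (B + B') C F = D A B C F + D A B' C F.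
  by rewrite (D12 (B + B') A) DD opprD -!D12.
have DD3 A B C C' F : D A B (C + C') F = D A B C F + D A B C' F.
  by rewrite sym DD -!(sym A B).
have DD4 A B C F F' : D A B C (F + F') = D A B C F + D A B C F'.
  by rewrite sym DDr -!(sym A B).
have JN A : J (- A) = - J A.
  have J0 : J 0 = 0 by apply: (addrI (J 0)); rewrite -JD !addr0.
  by apply: (addrI (J A)); rewrite -JD !subrr.
have DN1 A B C F : D (- A) B C F = - D A B C F.
  have D0 : D 0 B C F = 0 by have := DD 0 0 B C F; rewrite addr0; lra.
  by have := DD A (- A) B C F; rewrite subrr D0; lra.
have DN2 A B C F : D A (- B) C F = - D A B C F by rewrite (D12 (- B) A) DN1 -D12.
have DN3 A B C F : D A B (- C) F = - D A B C F by rewrite sym DN1 -sym.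
have DN4 A B C F : D A B C (- F) = - D A B C F by rewrite sym DN2 -sym.
have DJl A B C F : D (J A) (J B) C F = D A B C F by rewrite sym DJ -sym.
have Jx A B C F : D A (J B) C F = D B (J A) C F.
  by rewrite -(DJl A) JJ DN2 (D12 B (J A)) opprK.
have Dh A : D A (J A) A (J A) = 0 by have := D34 A (J A) A (J A); rewrite Dhol; lra.
(* Polarising the vanishing of X |-> D(X, JX, X, JX) along X + Y and X - Y. *)
have P1 A B : D A (J A) B (J B) + 2 * D A (J B) A (J B) = 0.
  have := Dh (A + B); have := Dh (A - B).
  rewrite !JD !JN !(DD, DDr, DD3, DD4, DN1, DN2, DN3, DN4) !Dh.
  rewrite !(Jx B A) (sym B (J B) A (J A)).
  rewrite !(sym _ _ B (J A)) !(Jx B A).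
  have := sym B (J B) A (J B); have := sym A (J A) A (J B); lra.
have P2 A B : 3 * D A (J B) A (J B) + D A B A B = 0.
  have := P1 A B; have := DB A (J A) B (J B).
  have := D12 B (J A) A (J B); have := Jx A B A (J B).
  have := DJ B A A B; have := D12 A B A B.
  lra.
have P3 A B : D A B A B = 0.
  have := P2 A B; have := P2 A (J B); rewrite JJ !(DN2, DN4); lra.
have P4 A B F : D A B A F = 0.
  have := P3 A (B + F); rewrite DDr !DD4 !P3 (sym A F); lra.
have P5 A B C F : D A B C F = - D C B A F.
  have := P4 (A + C) B F; rewrite DD !DD3 !P4; lra.
have := DB X Y Z W; have := P5 X Y Z W; have := P5 Y Z X W.
have := D12 Y Z X W; have := D12 Z X Y W; lra.
Qed.

End KahlerAlgebra.

(** Renames the indices of a trilinear expression, so that the three cyclic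
    terms of the Bianchi identity share the same coefficients. *)
Lemma sum3_rot (R : comRingType) (V : lmodType R) (n : nat)
    (x y z : 'rV[R]_n) (T : 'I_n -> 'I_n -> 'I_n -> V) :
  \sum_a \sum_b \sum_d (x 0 a * y 0 b * z 0 d) *: T a b d
  = \sum_a \sum_b \sum_d (z 0 a * x 0 b * y 0 d) *: T b d a.
Proof.
transitivity (\sum_a \sum_d \sum_b (x 0 a * y 0 b * z 0 d) *: T a b d).
  by apply: eq_bigr => a _; rewrite exchange_big.
rewrite exchange_big; apply: eq_bigr => d _; apply: eq_bigr => a _.
by apply: eq_bigr => b _; congr (_ *: _); rewrite mulrC mulrA.
Qed.

Section CurvatureTensor.
Context (R : realType) (n : nat) (V : set 'rV[R]_n) (h : 'rV[R]_n -> 'M[R]_n).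
Hypotheses (oV : open V) (hV : metric_on V h).
Implicit Types (X Y Z W p : 'rV[R]_n).

Lemma jac_id p : jac (id : 'rV[R]_n -> 'rV[R]_n) p = 1%:M.
Proof.
apply/matrixP => i a; rewrite mxE (pd_coord i a p) !mxE.
by rewrite eqxx /= eq_sym.
Qed.

Lemma msmooth_id : msmooth V (id : 'rV[R]_n -> 'rV[R]_n).
Proof. by move=> a b; rewrite (ord1 a); apply: smooth_on_coord. Qed.

Lemma cform_id a p : cform h id a p = conn h a p.
Proof.
rewrite /cform jac_id (bigD1 a) //= mxE eqxx scale1r big1 ?addr0 // => b ba.
by rewrite mxE eq_sym (negPf ba) scale0r.
Qed.

Lemma covD_id_cst a X p : covD h id a (fun=> X) p = X *m conn h a p.
Proof. by rewrite covDE mpd_cst add0r cform_id. Qed.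

Lemma covD_id_comm a b Z p : V p ->
  covD h id a (covD h id b (fun=> Z)) p - covD h id b (covD h id a (fun=> Z)) p
  = Z *m curv_mx h a b p.
Proof.
move=> Vp; have idV q : V q -> V (id q) by [].
rewrite (covD_comm oV oV hV idV msmooth_id a b Vp (msmooth_cst Z oV)).
rewrite (cform_curv oV oV hV idV msmooth_id a b Vp) jac_id.
rewrite (bigD1 a) //= [X in _ + X]big1 ?addr0.
  rewrite (bigD1 b) //= [X in _ + X]big1 ?addr0.
    by rewrite !mxE !eqxx mulr1 scale1r.
  by move=> d db; rewrite !mxE [b == d]eq_sym (negPf db) mulr0 scale0r.
move=> d da; rewrite big1 // => d' _.
by rewrite !mxE [a == d]eq_sym (negPf da) mul0r scale0r.
Qed.

Lemma curvE X Y Z p : V p ->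
  curv h p X Y Z = Z *m (\sum_a \sum_b (X 0 a * Y 0 b) *: curv_mx h a b p).
Proof.
move=> Vp; rewrite /curv mulmx_sumr; apply: eq_bigr => a _.
rewrite mulmx_sumr; apply: eq_bigr => b _.
under eq_bigr => d _ do rewrite (covD_id_comm _ _ _ Vp) -scalerA scalemxAl.
rewrite -scaler_sumr -mulmx_suml -scalemxAr; congr (_ *: (_ *m _)).
by rewrite -row_sum_delta.
Qed.

Lemma covD_curv (m : nat) (U : set 'rV[R]_m) (f : 'rV[R]_m -> 'rV[R]_n)
    (i j : 'I_m) (X : 'rV[R]_m -> 'rV[R]_n) u :
  open U -> (forall u, U u -> V (f u)) -> msmooth U f -> msmooth U X -> U u ->
  covD h f i (covD h f j X) u - covD h f j (covD h f i X) u
  = curv h (f u) (dmap f u 'e_i) (dmap f u 'e_j) (X u).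
Proof.
move=> oU fUV sf sX Uu.
rewrite (covD_comm oU oV hV fUV sf i j Uu sX) (cform_curv oU oV hV fUV sf i j Uu).
rewrite (curvE _ _ _ (fUV _ Uu)); congr (_ *m _).
have dmapE k c : dmap f u 'e_k 0 c = jac f u k c by rewrite /dmap -rowE mxE.
by apply: eq_bigr => a _; apply: eq_bigr => b _; rewrite !dmapE.
Qed.

Lemma curvDl X X' Y Z p : V p ->
  curv h p (X + X') Y Z = curv h p X Y Z + curv h p X' Y Z.
Proof.
move=> Vp; rewrite !curvE // -mulmxDr -big_split; congr (_ *m _).
apply: eq_bigr => a _; rewrite -big_split; apply: eq_bigr => b _.
by rewrite /= mxE mulrDl scalerDl.
Qed.

Lemma curv12 X Y Z p : V p -> curv h p Y X Z = - curv h p X Y Z.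
Proof.
move=> Vp; rewrite !curvE // -mulmxN exchange_big /=; congr (_ *m _).
rewrite -sumrN; apply: eq_bigr => a _; rewrite -sumrN; apply: eq_bigr => b _.
by rewrite mulrC -scalerN /curv_mx opprD !opprB.
Qed.

(** R(d_a, d_b) is skew for the metric: differentiate twice the scalar product
    of the constant fields Z and W and use the symmetry of second
    derivatives; the mixed terms <nabla_a Z, nabla_b W> cancel. *)
Lemma curv_mx_skew a b Z W p : V p ->
  ip h p (Z *m curv_mx h a b p) W + ip h p Z (W *m curv_mx h a b p) = 0.
Proof.
move=> Vp; have idV q : V q -> V (id q) by [].
pose F q := ip h q Z W; pose N c X := covD h id c (fun=> X).
have sc X := msmooth_cst X oV.
have sN c X : msmooth V (N c X) := covD_smooth oV oV hV idV msmooth_id c (sc X).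
have sF : smooth_on V F := ip_smooth oV hV idV msmooth_id (sc Z) (sc W).
have ip_s (X Y : 'rV[R]_n -> 'rV[R]_n) : msmooth V X -> msmooth V Y ->
  smooth_on V (fun v => ip h v (X v) (Y v)).
  by move=> sX sY; apply: (ip_smooth oV hV idV msmooth_id sX sY).
have pdip c (X Y : 'rV[R]_n -> 'rV[R]_n) q : V q -> msmooth V X -> msmooth V Y ->
  pd c (fun v => ip h v (X v) (Y v)) q =
   ip h q (covD h id c X q) (Y q) + ip h q (X q) (covD h id c Y q).
  move=> Vq sX sY.
  exact: (pd_ip oV oV hV idV msmooth_id c Vq (msmooth_diff sX Vq) (msmooth_diff sY Vq)).
have d1 c q : V q -> pd c F q = ip h q (N c Z q) W + ip h q Z (N c W q).
  by move=> Vq; exact: (pdip c (fun=> Z) (fun=> W) q Vq (sc Z) (sc W)).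
have d2 c d : pd c (pd d F) p =
   ip h p (covD h id c (N d Z) p) W + ip h p (N d Z p) (N c W p)
   + (ip h p (N c Z p) (N d W p) + ip h p Z (covD h id c (N d W) p)).
  rewrite (pd_eq_on oV c (d1 d) Vp).
  rewrite pdD; [|exact: smooth_on_diff (ip_s _ _ (sN d Z) (sc W)) Vp
                |exact: smooth_on_diff (ip_s _ _ (sc Z) (sN d W)) Vp].
  congr (_ + _); first exact: (pdip c (N d Z) (fun=> W) p Vp (sN d Z) (sc W)).
  exact: (pdip c (fun=> Z) (N d W) p Vp (sc Z) (sN d W)).
have := pdC a b oV Vp sF; rewrite (d2 a b) (d2 b a).
rewrite -!(covD_id_comm a b _ Vp) -/(N a Z) -/(N b Z) -/(N a W) -/(N b W).
rewrite ipDl ipDr ipNl ipNr.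
set x1 := ip _ _ _ _; set x2 := ip _ _ _ _; set x3 := ip _ _ _ _; set x4 := ip _ _ _ _.
set x5 := ip _ _ _ _; set x6 := ip _ _ _ _.
clearbody x1 x2 x3 x4 x5 x6 => H; lra.
Qed.

Lemma curv34 X Y Z W p : V p -> ip h p (curv h p X Y W) Z = - ip h p (curv h p X Y Z) W.
Proof.
move=> Vp; have [_ hs _] := hV; apply/eqP; rewrite -addr_eq0; apply/eqP.
rewrite (ipC _ Z (hs _ Vp)) !curvE // !mulmx_sumr ip_suml ip_sumr -big_split /=.
apply: big1 => a _; rewrite !mulmx_sumr ip_suml ip_sumr -big_split /=.
apply: big1 => b _; rewrite -!scalemxAr ipZl ipZr -mulrDr addrC.
by rewrite curv_mx_skew // mulr0.
Qed.

(** The first Bianchi identity follows from nabla_a d_b = nabla_b d_a, which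
    pairs the six second derivatives. *)
Lemma curv_mx_bianchi a b d p : V p ->
  ('e_d : 'rV[R]_n) *m curv_mx h a b p + ('e_a :
    'rV[R]_n) *m curv_mx h b d p + ('e_b : 'rV[R]_n) *m curv_mx h d a p = 0.
Proof.
move=> Vp; have idV q : V q -> V (id q) by [].
have T i j q : V q -> covD h id i (fun=> ('e_j :
  'rV[R]_n)) q = covD h id j (fun=> ('e_i : 'rV[R]_n)) q.
  move=> Vq; have E k : (fun r : 'rV[R]_n => dmap id r 'e_k) = fun=> 'e_k.
    by apply/funext => r; rewrite /dmap jac_id mulmx1.
  by have := torsion_free oV oV hV idV msmooth_id i j Vq; rewrite !E.
rewrite -!covD_id_comm //.
rewrite (covD_eq_on h id oV b (T a d) Vp) (covD_eq_on h id oV a (T b d) Vp).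
rewrite (covD_eq_on h id oV d (T a b) Vp).
set x := covD _ _ _ _ _; set y := covD _ _ _ _ _; set z := covD _ _ _ _ _.
by clearbody x y z; apply/rowP => l; rewrite !mxE; ring.
Qed.

Lemma curv_bianchi X Y Z p : V p ->
  curv h p X Y Z + curv h p Y Z X + curv h p Z X Y = 0.
Proof.
move=> Vp; pose K a b d : 'rV[R]_n := ('e_d : 'rV[R]_n) *m curv_mx h a b p.
have C X' Y' Z' : curv h p X' Y' Z'
  = \sum_a \sum_b \sum_d (X' 0 a * Y' 0 b * Z' 0 d) *: K a b d.
  apply: eq_bigr => a _; apply: eq_bigr => b _; apply: eq_bigr => d _.
  by rewrite covD_id_comm.
have KB a b d : K a b d + K b d a + K d a b = 0 by exact: curv_mx_bianchi.
rewrite (C X Y Z) (C Y Z X) (C Z X Y); clearbody K.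
rewrite (sum3_rot Z X Y) !(sum3_rot Y Z X).
rewrite -!big_split big1 // => a _; rewrite -!big_split big1 // => b _.
rewrite -!big_split big1 // => d _ /=.
by rewrite -!scalerDr KB scaler0.
Qed.

End CurvatureTensor.

(** * Curvature of complex space forms *)

Section Kahler.
Context (R : realType) (n : nat) (V : set 'rV[R]_n) (h : 'rV[R]_n -> 'M[R]_n).
Context (J : 'M[R]_n).
Hypotheses (oV : open V) (hV : metric_on V h) (JJ : J *m J = - 1%:M).
Hypothesis Jherm : forall p, V p -> forall X Y, ip h p (X *m J) (Y *m J) = ip h p X Y.
Hypothesis Jpar : forall p, V p -> forall a b : 'I_n,
  covD h id a (fun=> ('e_b : 'rV[R]_n) *m J) p = covD h id a (fun=> ('e_b :
    'rV[R]_n)) p *m J.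
Implicit Types (X Y Z W p : 'rV[R]_n).

Lemma mulJJ X : X *m J *m J = - X.
Proof. by rewrite -mulmxA JJ mulmxN mulmx1. Qed.

Lemma ip_J p X Y : V p -> ip h p (X *m J) Y = - ip h p X (Y *m J).
Proof. by move=> Vp; rewrite -(Jherm Vp X) mulJJ ipNr opprK. Qed.

Lemma ip_JX0 p X : V p -> ip h p (X *m J) X = 0.
Proof.
move=> Vp; have [_ hs _] := hV; have := ip_J X X Vp.
by rewrite [ip h p X (X *m J)](ipC _ _ (hs _ Vp)) => ?; lra.
Qed.

(** That J is parallel means that the connection matrices are complex linear;
    hence so are their derivatives and the curvature. *)
Lemma conn_J a p : V p -> J *m conn h a p = conn h a p *m J.
Proof.
move=> Vp; apply/row_matrixP => b; have := Jpar Vp a b.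
by rewrite !covD_id_cst !rowE !mulmxA.
Qed.

Lemma curv_mx_J a b p : V p -> J *m curv_mx h a b p = curv_mx h a b p *m J.
Proof.
move=> Vp.
have dc c : mdiff (conn h c) p := msmooth_diff (conn_smooth oV hV c) Vp.
have dJ : mdiff (fun _ : 'rV[R]_n => J) p := msmooth_diff (msmooth_cst J oV) Vp.
have mJ c d : J *m mpd c (conn h d) p = mpd c (conn h d) p *m J.
  have := mpd_eq_on c oV (fun q Vq => conn_J d Vq) Vp.
  by rewrite mpdM // mpdM // mpd_cst mul0mx add0r mulmx0 addr0.
rewrite /curv_mx !(mulmxDr, mulmxDl, mulmxN, mulNmx) !mJ !mulmxA !conn_J //.
by rewrite -!mulmxA !conn_J.
Qed.

Lemma curv_J X Y Z p : V p -> curv h p X Y (Z *m J) = curv h p X Y Z *m J.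
Proof.
move=> Vp; rewrite !(curvE oV hV) // -!mulmxA; congr (_ *m _).
rewrite mulmx_sumr mulmx_suml; apply: eq_bigr => a _.
rewrite mulmx_sumr mulmx_suml; apply: eq_bigr => b _.
by rewrite -scalemxAr -scalemxAl curv_mx_J.
Qed.

Lemma covD_J (m : nat) (U : set 'rV[R]_m) (f : 'rV[R]_m -> 'rV[R]_n) (i : 'I_m)
    (X : 'rV[R]_m -> 'rV[R]_n) u :
  (forall u, U u -> V (f u)) -> U u -> mdiff X u ->
  covD h f i (fun v => X v *m J) u = covD h f i X u *m J.
Proof.
move=> fUV Uu dX; rewrite !covDE mpdM //.
rewrite mpd_cst mulmx0 addr0 mulmxDl -!mulmxA; congr (_ + _ *m _).
rewrite /cform mulmx_sumr mulmx_suml; apply: eq_bigr => a _.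
by rewrite -scalemxAr -scalemxAl conn_J //; apply: fUV.
Qed.

Context (c : R).
Hypothesis Jsec : forall p, V p -> forall X, X != 0 -> sec_curv h p X (X *m J) = c.

(** The difference of the two sides has the symmetries of a Kaehler curvature
    tensor and vanishing holomorphic sectional curvature, so that
    [kahler_curv_eq0] applies. *)
Lemma curv_space_form p X Y Z W : V p ->
  ip h p (curv h p X Y Z) W = c / 4 *
   (ip h p Y Z * ip h p X W - ip h p X Z * ip h p Y W
    + ip h p (Y *m J) Z * ip h p (X *m J) W - ip h p (X *m J) Z * ip h p (Y *m J) W
    + 2 * ip h p X (Y *m J) * ip h p (Z *m J) W).
Proof.
move=> Vp; have [_ hs hp] := hV.
have ipS A B := ipC A B (hs _ Vp).
pose M X Y Z W := c / 4 *
   (ip h p Y Z * ip h p X W - ip h p X Z * ip h p Y W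
    + ip h p (Y *m J) Z * ip h p (X *m J) W - ip h p (X *m J) Z * ip h p (Y *m J) W
    + 2 * ip h p X (Y *m J) * ip h p (Z *m J) W).
pose D X Y Z W := ip h p (curv h p X Y Z) W - M X Y Z W.
suff : D X Y Z W = 0 by move/eqP; rewrite subr_eq0 => /eqP.
have Jsk A B : ip h p A (B *m J) = - ip h p (A *m J) B by rewrite ip_J // opprK.
have Js A B : ip h p (B *m J) A = - ip h p (A *m J) B by rewrite ipS Jsk.
apply: (@kahler_curv_eq0 R _ (fun X => X *m J) D); rewrite /D /M.
- exact: mulJJ.
- by move=> A B; rewrite mulmxDl.
- move=> A A' B C F; rewrite (curvDl oV hV) // !mulmxDl !ipDl; ring.
- by move=> A B C F; rewrite (curv12 oV hV _ _ _ Vp) ipNl !Jsk (Js A B); ring.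
- by move=> A B C F; rewrite (curv34 oV hV _ _ _ _ Vp) (Js C F); ring.
- move=> A B C F.
  have := congr1 (fun v => ip h p v F) (curv_bianchi oV hV A B C Vp).
  rewrite !ipDl ip0l (ipS C A) (ipS C B) (ipS B A) !Jsk (Js A B) (Js A C) (Js B C).
  by move=> H; lra.
- by move=> A B C F; rewrite curv_J // !Jherm // !Jsk; ring.
- move=> A; have [->|A0] := eqVneq A 0.
    by rewrite mul0mx !ip0l !ip0r; ring.
  have := Jsec Vp A0; rewrite /sec_curv Jherm // (Jsk A A) (ip_JX0 _ Vp) oppr0 expr0n subr0.
  have A2 : ip h p A A != 0 by rewrite gt_eqF ?hp.
  move=> /(canRL (divfK _)) -> ; last by rewrite mulf_neq0.
  rewrite mulJJ !ipNl !ipNr.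
  by field.
Qed.

End Kahler.

(** * Isometric immersions *)

Section IsometricImmersion.
Context (R : realType) (m n : nat) (U : set 'rV[R]_m) (V : set 'rV[R]_n).
Context (g : 'rV[R]_m -> 'M[R]_m) (h : 'rV[R]_n -> 'M[R]_n).
Context (f : 'rV[R]_m -> 'rV[R]_n).
Hypotheses (oU : open U) (oV : open V) (gU : metric_on U g) (hV : metric_on V h).
Hypotheses (fUV : forall u, U u -> V (f u)) (sf : msmooth U f).
Hypothesis iso : forall u, U u -> forall X Y,
  ip h (f u) (dmap f u X) (dmap f u Y) = ip g u X Y.
Implicit Types (i j k : 'I_m) (u : 'rV[R]_m) (v w : 'rV[R]_n).

Definition cvec j u : 'rV[R]_n := dmap f u 'e_j.

Lemma dmap_sum u X : dmap f u X = \sum_j X 0 j *: cvec j u.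
Proof.
rewrite /dmap {1}(row_sum_delta X) mulmx_suml; apply: eq_bigr => j _.
by rewrite -scalemxAl.
Qed.

Lemma cvec_smooth j : msmooth U (cvec j).
Proof.
move=> a b; apply: (smooth_on_eq oU _ (msmooth_jac sf j b)) => v _.
by rewrite /cvec /dmap -rowE [RHS]mxE.
Qed.

Lemma cvec_ip i j u : U u -> ip h (f u) (cvec i u) (cvec j u) = g u i j.
Proof. by move=> Uu; rewrite iso // /ip -rowE trmx_delta -colE !mxE. Qed.

Lemma cvec_covD_sym i j u : U u ->
  covD h f i (cvec j) u = covD h f j (cvec i) u.
Proof. exact: torsion_free oU oV hV fUV sf i j u. Qed.

(** The tangential part of D_i E_j is given by the Christoffel symbols of g:
    this is the Koszul formula, g_jk being <E_j, E_k>. *)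
Lemma gauss_formula i j k u : U u ->
  ip h (f u) (covD h f i (cvec j) u) (cvec k u) = (conn g i u *m g u) j k.
Proof.
move=> Uu; rewrite (christoffel_lower gU) //.
have pdg a b c : pd a (fun q => g q b c) u =
  ip h (f u) (covD h f a (cvec b) u) (cvec c u)
  + ip h (f u) (cvec b u) (covD h f a (cvec c) u).
  rewrite -(pd_ip oU oV hV fUV sf a Uu (msmooth_diff (cvec_smooth b) Uu)
    (msmooth_diff (cvec_smooth c) Uu)).
  by apply: (pd_eq_on oU) => // v Uv; rewrite cvec_ip.
have [_ hs _] := hV; have ipS := ipC _ _ (hs _ (fUV Uu)).
rewrite !pdg (cvec_covD_sym i k Uu) (cvec_covD_sym j k Uu) (cvec_covD_sym j i Uu).
rewrite ![ip _ _ (cvec _ _) _]ipS; set x := ip _ _ _ _; set y := ip _ _ _ _.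
by set z := ip _ _ _ _; field.
Qed.

Lemma sffE i j u : sff g h f i j u
  = covD h f i (cvec j) u - \sum_l conn g i u j l *: cvec l u.
Proof.
rewrite /sff dmap_sum covD_id_cst; congr (_ - _).
by apply: eq_bigr => l _; rewrite -rowE [row _ _ _ _]mxE.
Qed.

Lemma sff_normal i j k u : U u -> ip h (f u) (sff g h f i j u) (cvec k u) = 0.
Proof.
move=> Uu; rewrite sffE ipDl ipNl gauss_formula // ip_suml [X in X - _]mxE.
apply/eqP; rewrite subr_eq0; apply/eqP; apply: eq_bigr => l _.
by rewrite ipZl cvec_ip.
Qed.

Lemma sff_smooth i j : msmooth U (sff g h f i j).
Proof.
have sE : msmooth U (fun q => covD h f i (cvec j) q
  - \sum_l conn g i q j l *: cvec l q).
  apply: msmoothB => //.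
    by apply: (covD_smooth oU oV hV fUV sf); exact: cvec_smooth.
  apply: msmooth_sum => // l; apply: msmoothZ => //; last exact: cvec_smooth.
  exact: (conn_smooth oU gU i j l).
by apply: (msmooth_eq oU _ sE) => q _; rewrite sffE.
Qed.

Lemma gtrace_ip u (S : 'I_m -> 'I_m -> 'rV[R]_n) w : ip h (f u) (gtrace g u S) w
  = \sum_i \sum_j invmx (g u) i j * ip h (f u) (S i j) w.
Proof.
rewrite /gtrace ip_suml; apply: eq_bigr => i _.
by rewrite ip_suml; apply: eq_bigr => j _; rewrite ipZl.
Qed.

Lemma mean_curv_smooth : msmooth U (mean_curv g h f).
Proof.
apply: msmoothZ => //; first exact: smooth_on_cst.
apply: msmooth_sum => // i; apply: msmooth_sum => // j; apply: msmoothZ => //.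
  have [sg _ _] := gU.
  exact: smooth_on_invmx oU (metric_unit gU) sg.
exact: sff_smooth.
Qed.

Lemma is_normalP u v : is_normal h f u v <-> forall k, ip h (f u) v (cvec k u) = 0.
Proof.
split=> [nv k|nv X]; first exact: nv.
by rewrite dmap_sum ip_sumr big1 // => j _; rewrite ipZr nv mulr0.
Qed.

Lemma mean_curv_normal k u : U u -> ip h (f u) (mean_curv g h f u) (cvec k u) = 0.
Proof.
move=> Uu; rewrite /mean_curv ipZl gtrace_ip big1 ?mulr0 // => i _.
by rewrite big1 // => j _; rewrite sff_normal ?mulr0.
Qed.

(** [tan_part] is the orthogonal projection on the tangent space: the
    inverse Gram matrix inverts v |-> (<v, E_k>)_k on tangent vectors. *)
Lemma tan_part_ip u v k : U u ->
  ip h (f u) (tan_part g h f u v) (cvec k u) = ip h (f u) v (cvec k u).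
Proof.
move=> Uu; rewrite /tan_part gtrace_ip.
under eq_bigr => i _ do under eq_bigr => j _ do
  rewrite ipZl -/(cvec i u) -/(cvec j u) cvec_ip // mulrCA.
under eq_bigr => i _ do rewrite -mulr_sumr.
rewrite (bigD1 k) //= [X in _ + X]big1 ?addr0 => [|i ik].
  have := congr1 (fun A : 'M[R]_m => A k k) (mulVmx (metric_unit gU Uu)).
  by rewrite !mxE eqxx => ->; rewrite mulr1.
have := congr1 (fun A : 'M[R]_m => A i k) (mulVmx (metric_unit gU Uu)).
by rewrite !mxE (negPf ik) => ->; rewrite mulr0.
Qed.

End IsometricImmersion.

(** * Orthogonal frames of a plane and its normal plane *)

Lemma big_ord2 (M : nmodType) (F : 'I_2 -> M) : \sum_i F i = F 0 + F 1.
Proof. by rewrite !big_ord_recl big_ord0 addr0; congr (_ + F _); apply: val_inj. Qed.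

Lemma ord2P (P : 'I_2 -> Prop) : P 0 -> P 1 -> forall i, P i.
Proof.
move=> P0 P1 [[|[|//]] lti].
  by rewrite (_ : Ordinal lti = 0) //; apply: val_inj.
by rewrite (_ : Ordinal lti = 1) //; apply: val_inj.
Qed.

Lemma mul_mx_ip (R : realType) (k l n : nat) (h : 'rV[R]_n -> 'M[R]_n) p
    (A : 'M[R]_(k, n)) (B : 'M[R]_(l, n)) i j :
  (A *m h p *m B^T) i j = ip h p (row i A) (row j B).
Proof.
rewrite /ip mxE [RHS]mxE; apply: eq_bigr => b _.
by rewrite -row_mul [row _ _ _ _]mxE !mxE.
Qed.

(** The rows of A and B form a basis, because their Gram matrix is block
    diagonal with invertible blocks; only 0 is orthogonal to a basis. *)
Lemma orth_blocks_eq0 (R : realType) (k l : nat) (h : 'rV[R]_(k + l) -> 'M[R]_(k + l)) p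
    (A : 'M[R]_(k, k + l)) (B : 'M[R]_(l, k + l)) (v : 'rV[R]_(k + l)) :
  A *m h p *m A^T \in unitmx -> B *m h p *m B^T \in unitmx ->
  (forall i j, ip h p (row i A) (row j B) = 0) ->
  (forall i, ip h p v (row i A) = 0) -> (forall i, ip h p v (row i B) = 0) -> v = 0.
Proof.
move=> uA uB AB vA vB.
have AB0 : A *m h p *m B^T = 0 by apply/matrixP => i j; rewrite mul_mx_ip AB mxE.
pose F := col_mx A B.
have : F *m (h p *m F^T) \in unitmx.
  rewrite mulmxA /F mul_col_mx tr_col_mx mul_col_row AB0.
  by rewrite unitmxE det_lblock unitrM -!unitmxE uA.
rewrite unitmx_mul => /andP[_ uF].
have vF : v *m (h p *m F^T) = 0.
  rewrite mulmxA tr_col_mx mul_mx_row.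
  rewrite (_ : v *m h p *m A^T = 0); last first.
    by apply/matrixP => i j; rewrite mul_mx_ip (ord1 i) row_id vA mxE.
  rewrite (_ : v *m h p *m B^T = 0) ?row_mx0 //.
  by apply/matrixP => i j; rewrite mul_mx_ip (ord1 i) row_id vB mxE.
by rewrite -(mulmxK uF v) vF mul0mx.
Qed.

Lemma orthonormal4_expansion (R : realType) (h : 'rV[R]_(2 + 2) -> 'M[R]_(2 + 2)) p
    (x y z t v : 'rV[R]_(2 + 2)) : (h p)^T = h p ->
  ip h p x x = 1 -> ip h p x y = 0 -> ip h p x z = 0 -> ip h p x t = 0 ->
  ip h p y y = 1 -> ip h p y z = 0 -> ip h p y t = 0 ->
  ip h p z z = 1 -> ip h p z t = 0 -> ip h p t t = 1 ->
  v = ip h p v x *: x + ip h p v y *: y + ip h p v z *: z + ip h p v t *: t.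
Proof.
move=> hs xx xy xz xt yy yz yt zz zt tt.
pose A := col_mx x y; pose B := col_mx z t.
have row2 (a b : 'rV[R]_(2 + 2)) :
    row (0 : 'I_2) (col_mx a b) = a /\ row (1 : 'I_2) (col_mx a b) = b.
  have l : (0 : 'I_(1 + 1)) = lshift 1 0 by exact: val_inj.
  have rr : (1 : 'I_(1 + 1)) = rshift 1 0 by exact: val_inj.
  split; first exact: etrans (congr1 (fun i => row i (col_mx a b)) l) (etrans (rowKu 0 a b) (row_id 0 a)).
  exact: etrans (congr1 (fun i => row i (col_mx a b)) rr) (etrans (rowKd 0 a b) (row_id 0 b)).
have [A0 A1] := row2 x y; have [B0 B1] := row2 z t.
apply/eqP; rewrite -subr_eq0; apply/eqP.
have S := ipC _ _ hs.
have tab := (xx, xy, xz, xt, yy, yz, yt, zz, zt, tt, etrans (S y x) xy,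
  etrans (S z x) xz, etrans (S z y) yz, etrans (S t x) xt, etrans (S t y) yt,
    etrans (S t z) zt).
apply: (@orth_blocks_eq0 R 2 2 h p A B).
- rewrite (_ : _ *m _ *m _ = 1%:M) ?unitmx1 //.
  by apply/matrixP; apply: ord2P; apply: ord2P; rewrite mul_mx_ip ?A0 ?A1 !tab mxE.
- rewrite (_ : _ *m _ *m _ = 1%:M) ?unitmx1 //.
  by apply/matrixP; apply: ord2P; apply: ord2P; rewrite mul_mx_ip ?B0 ?B1 !tab mxE.
- by apply: ord2P; apply: ord2P; rewrite ?A0 ?A1 ?B0 ?B1 !tab.
- by apply: ord2P; rewrite ?A0 ?A1 ipDl ipNl !ipDl !ipZl !tab; ring.
- by apply: ord2P; rewrite ?B0 ?B1 ipDl ipNl !ipDl !ipZl !tab; ring.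
Qed.

(** If G = p^T p + q^T q, then p and q are dual to vectors orthonormal for G,
    and the G-trace of x (x) p + y (x) q is the sum of the values of x and y on
    these dual vectors.  Multiplying by the determinant of (p, q) clears the
    denominators. *)
Lemma gram_trace (R : fieldType) (G : 'M[R]_2) (p q : 'I_2 -> R) :
  (forall i j, G i j = p i * p j + q i * q j) -> G \in unitmx ->
  p 0 * q 1 - p 1 * q 0 != 0 /\
  forall x y : 'I_2 -> R,
    (\sum_i \sum_j invmx G i j * (x i * p j + y i * q j)) * (p 0 * q 1 - p 1 * q 0)
    = x 0 * q 1 - x 1 * q 0 - y 0 * p 1 + y 1 * p 0.
Proof.
move=> GE uG; set d := _ - _.
have d0 : d != 0.
  apply/eqP => d0.
  have ker (v : 'rV[R]_2) : v 0 0 * p 0 + v 0 1 * p 1 = 0 ->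
      v 0 0 * q 0 + v 0 1 * q 1 = 0 -> v = 0.
    move=> vp vq; rewrite -(mulmxK uG v) (_ : v *m G = 0) ?mul0mx //.
    apply/rowP => j; rewrite !mxE big_ord2 !GE.
    by transitivity ((v 0 0 * p 0 + v 0 1 * p 1) * p j + (v 0 0 * q 0
      + v 0 1 * q 1) * q j);
      [ring | rewrite vp vq !mul0r addr0].
  have comb a b : a * p 0 + b * p 1 = 0 -> a * q 0 + b * q 1 = 0 -> a = 0 /\ b = 0.
    move=> ap aq; have /rowP W : \row_(j < 2) (if j == 0 then a else b) = 0 by
      apply: ker; rewrite !mxE.
    by split; [have := W 0 | have := W 1]; rewrite !mxE.
  have [q1 q0] : q 1 = 0 /\ - q 0 = 0 by apply: comb; [rewrite -d0 /d; ring | ring].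
  have [p1 p0] : p 1 = 0 /\ - p 0 = 0.
    by apply: comb; [ring | transitivity (- d); [rewrite /d; ring | rewrite d0 oppr0]].
  have [] : (1 : R) = 0 /\ (0 : R) = 0.
    move/eqP: p0; rewrite oppr_eq0 => /eqP p0; move/eqP: q0;
      rewrite oppr_eq0 => /eqP q0.
    by apply: comb; rewrite ?p0 ?p1 ?q0 ?q1; ring.
  by move/eqP; rewrite oner_eq0.
split=> // x y.
pose c1 (i : 'I_2) := if i == 0 then q 1 else - q 0.
pose c2 (i : 'I_2) := if i == 0 then - p 1 else p 0.
have -> : invmx G = \matrix_(i, j) ((c1 i * c1 j + c2 i * c2 j) / d ^+ 2).
  set K := \matrix_(_, _) _; have KG : K *m G = 1%:M.
    apply/matrixP; apply: ord2P; apply: ord2P;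
      rewrite !mxE big_ord2 !mxE !GE /c1 /c2 /=; rewrite /d; field; exact: d0.
  by rewrite -[LHS]mul1mx -KG mulmxK.
rewrite !big_ord2 !mxE /c1 /c2 /= /d; field; exact: d0.
Qed.

(** * The surface is totally real *)

Section TotallyReal.
Context (R : realType) (U : set 'rV[R]_2) (V : set 'rV[R]_(2 + 2)).
Context (g : 'rV[R]_2 -> 'M[R]_2) (h : 'rV[R]_(2 + 2) -> 'M[R]_(2 + 2)).
Context (f : 'rV[R]_2 -> 'rV[R]_(2 + 2)) (J : 'M[R]_(2 + 2)).
Hypotheses (oU : open U) (oV : open V) (gU : metric_on U g) (hV : metric_on V h).
Hypotheses (fUV : forall u, U u -> V (f u)) (sf : msmooth U f).
Hypothesis iso : forall u, U u -> forall X Y,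
  ip h (f u) (dmap f u X) (dmap f u Y) = ip g u X Y.
Hypothesis JJ : J *m J = - 1%:M.
Hypothesis Jherm : forall p, V p -> forall X Y, ip h p (X *m J) (Y *m J) = ip h p X Y.
Hypothesis Jpar : forall p, V p -> forall a b : 'I_(2 + 2),
  covD h id a (fun=> ('e_b : 'rV[R]_(2 + 2)) *m J) p
  = covD h id a (fun=> ('e_b : 'rV[R]_(2 + 2))) p *m J.
Local Notation H := (mean_curv g h f).
Local Notation E := (cvec f).
Local Notation "''<' v , w >_ u" := (ip h (f u) v w) (at level 0, u at level 0,
  v, w at level 200, format "''<' v ,  w >_ u").
Hypothesis H_neq0 : forall u, U u -> H u != 0.
Hypothesis JT_normal : forall u, U u ->
  is_normal h f u (tan_part g h f u (H u *m J) *m J).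
Implicit Types (i j k : 'I_2) (u : 'rV[R]_2) (v w : 'rV[R]_(2 + 2)).

Let ipS u v w : U u -> '<v, w>_u = '<w, v>_u.
Proof. by move=> Uu; have [_ hs _] := hV; apply: ipC; apply: hs; apply: fUV. Qed.

Let ipJ u v w : U u -> '<v *m J, w>_u = - '<v, w *m J>_u.
Proof. by move=> Uu; apply: (ip_J JJ Jherm); apply: fUV. Qed.

Let ipJ0 u v : U u -> '<v *m J, v>_u = 0.
Proof. by move=> Uu; apply: (ip_JX0 hV JJ Jherm); apply: fUV. Qed.

(** The Kaehler form of the ambient space on (E_0, E_1); its vanishing means
    that the surface is totally real. *)
Definition kahler_form01 u : R := '<E 0 u *m J, E 1 u>_u.
Local Notation kap := kahler_form01.

Lemma kahler_form01_swap u : U u -> '<E 1 u *m J, E 0 u>_u = - kap u.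
Proof. by move=> Uu; rewrite ipJ // ipS. Qed.

Lemma tan_partE u v : tan_part g h f u v =
  \sum_j (\sum_i invmx (g u) i j * '<v, E i u>_u) *: E j u.
Proof.
rewrite /tan_part /gtrace exchange_big /=; apply: eq_bigr => j _.
by rewrite scaler_suml; apply: eq_bigr => i _; rewrite scalerA.
Qed.

(** With T = t_0 E_0 + t_1 E_1 one has <JT, E_1> = t_0 k and
    <JT, E_0> = - t_1 k for k = <J E_0, E_1>, so JT normal forces T = 0. *)
Lemma JH_normal_of_form u k : U u -> kap u != 0 -> '<H u *m J, E k u>_u = 0.
Proof.
move=> Uu kap0; rewrite -(tan_part_ip gU iso _ _ Uu).
have := (is_normalP h f u _).1 (JT_normal Uu).
have [t ->] : exists t : 'I_2 -> R,
  tan_part g h f u (H u *m J) = \sum_j t j *: E j u by eexists; exact: tan_partE.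
move=> tn; have := tn 0; have := tn 1.
rewrite big_ord2 mulmxDl -!scalemxAl !ipDl !ipZl !ipJ0 // kahler_form01_swap // -/(kap u).
rewrite !mulr0 addr0 add0r mulrN => /eqP; rewrite mulf_eq0 (negPf kap0) orbF => /eqP->.
move=> /eqP; rewrite oppr_eq0 mulf_eq0 (negPf kap0) orbF => /eqP->.
by rewrite !mul0r addr0.
Qed.

Lemma mean_curv_gt0 u : U u -> 0 < '<H u, H u>_u.
Proof. by move=> Uu; have [_ _ hp] := hV; apply: hp (H_neq0 Uu); apply: fUV. Qed.

(** The normal plane is spanned by H and JH, and J E_j is orthogonal to both;
    so J maps tangent vectors to tangent vectors. *)
Lemma complex_tangent u j : U u -> (forall k, '<H u *m J, E k u>_u = 0) ->
  E j u *m J = tan_part g h f u (E j u *m J).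
Proof.
move=> Uu HJ0; apply/eqP; rewrite -subr_eq0; apply/eqP.
pose B : 'M[R]_(1 + 1, 2 + 2) := col_mx (H u) (H u *m J).
have rA i : row i (jac f u) = E i u by rewrite rowE.
have rB0 : row 0 B = H u.
  have e : (0 : 'I_(1 + 1)) = lshift 1 0 by exact: val_inj.
  exact: etrans (congr1 (fun i => row i B) e) (etrans (rowKu 0 (H u) (H u *m J)) (row_id 0 (H u))).
have rB1 : row 1 B = H u *m J.
  have e : (1 : 'I_(1 + 1)) = rshift 1 0 by exact: val_inj.
  exact: etrans (congr1 (fun i => row i B) e) (etrans (rowKd 0 (H u) (H u *m J)) (row_id 0 (H u *m J))).
have HH := mean_curv_gt0 Uu.
apply: (@orth_blocks_eq0 R 2 2 h (f u) (jac f u) B).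
- rewrite (_ : _ *m _ *m _ = g u) ?(metric_unit gU) //.
  by apply/matrixP => a b; rewrite mul_mx_ip !rA (cvec_ip iso).
- rewrite (_ : _ *m _ *m _ = ('<H u, H u>_u)%:M).
    by rewrite unitmxE det_scalar unitfE expf_neq0 ?gt_eqF.
  apply/matrixP; apply: ord2P; apply: ord2P;
    rewrite mul_mx_ip ?rB0 ?rB1 mxE ?mulr1n ?mulr0n //.
  + by rewrite ipS // ipJ0.
  + by rewrite ipJ0.
  + by rewrite Jherm //; apply: fUV.
- move=> a; apply: ord2P; rewrite rA ?rB0 ?rB1 ipS //.
  by rewrite (mean_curv_normal oU oV gU hV fUV sf iso).
- by move=> a; rewrite rA ipDl ipNl (tan_part_ip gU iso) // subrr.
- have T0 v w : (forall k, '<w, E k u>_u = 0) -> '<tan_part g h f u v, w>_u = 0.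
    move=> w0; rewrite tan_partE ip_suml big1 // => k _.
    by rewrite ipZl ipS // w0 mulr0.
  have Hn k := mean_curv_normal oU oV gU hV fUV sf iso k Uu.
  apply: ord2P; rewrite ?rB0 ?rB1 ipDl ipNl T0 // oppr0 addr0.
    by rewrite ipJ // ipS // HJ0 oppr0.
  by rewrite Jherm; [rewrite ipS | exact: fUV].
Qed.

(** If this form were nonzero at u, the surface would be a complex curve near u,
    hence minimal there, against H <> 0.  Below P is the second fundamental form
    in direction H, and [Q] expresses the one in direction JH through P; as both
    are symmetric, k = <J E_0, E_1> times the trace of P is 0. *)
Lemma kahler_form01_eq0 u : U u -> kap u = 0.
Proof.
move=> Uu; apply/eqP; apply: contraT => kap0.
have sE j := cvec_smooth oU sf j.
have sEJ j : msmooth U (fun q => E j q *m J) by apply: msmoothM => //;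
  exact: msmooth_cst.
have sH := mean_curv_smooth oU oV gU hV fUV sf.
have Hn k q : U q -> '<H q, E k q>_q = 0.
  by move=> Uq; exact: (mean_curv_normal oU oV gU hV fUV sf iso k Uq).
have skap : smooth_on U kap by apply: (ip_smooth oU hV fUV sf).
have ckap := differentiable_continuous (smooth_on_diff skap Uu).
have nearK : \forall q \near u, U q /\ kap q != 0.
  apply: filterI; first by apply: open_nbhs_nbhs.
  exact: (cvgr_neq0 (kap u) ckap kap0).
have EJH j : \forall q \near u, '<E j q *m J, H q>_q = 0.
  apply: filterS nearK => q [Uq kq].
  by rewrite ipJ // ipS // JH_normal_of_form // oppr0.
pose P i j := '<covD h f i (E j) u, H u>_u.
have PE i k : P i k = - '<E k u, covD h f i H u>_u.
  have := pd_ip oU oV hV fUV sf i Uu (msmooth_diff (sE k) Uu) (msmooth_diff sH Uu).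
  have -> : pd i (fun q => '<E k q, H q>_q) u = 0.
    rewrite (@pd_eq_on _ _ _ oU _ (fun=> 0)) ?pd_cst // => q Uq.
    by rewrite ipS // Hn.
  by move=> /esym/eqP; rewrite addr_eq0 => /eqP.
have QE i j : '<covD h f i (E j) u, H u *m J>_u = '<E j u *m J, covD h f i H u>_u.
  have := pd_ip oU oV hV fUV sf i Uu (msmooth_diff (sEJ j) Uu) (msmooth_diff sH Uu).
  have -> : pd i (fun q => '<E j q *m J, H q>_q) u = 0.
    by rewrite (@pd_near _ _ _ _ (fun=> 0)) ?pd_cst.
  rewrite (covD_J Jpar i fUV Uu (msmooth_diff (sE j) Uu)) ipJ // => /esym/eqP.
  by rewrite addrC subr_eq0 => /eqP.
have HJ0 k : '<H u *m J, E k u>_u = 0 by apply: JH_normal_of_form.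
have Q i j : '<covD h f i (E j) u, H u *m J>_u =
   - \sum_l (\sum_k invmx (g u) k l * '<E j u *m J, E k u>_u) * P i l.
  rewrite QE (complex_tangent j Uu HJ0) tan_partE ip_suml -sumrN.
  apply: eq_bigr => l _; rewrite ipZl PE mulrN opprK; congr (_ * _).
  apply: eq_bigr => k _; congr (_ * _).
  by rewrite -tan_partE -(complex_tangent j Uu HJ0).
have T0 : \sum_i \sum_j invmx (g u) i j * P i j = 0.
  have := Q 1 0; rewrite (cvec_covD_sym oU oV hV fUV sf 1 0 Uu) (Q 0 1).
  rewrite !big_ord2 !ipJ0 // kahler_form01_swap // -/(kap u) => K.
  apply: (mulfI kap0); rewrite mulr0.
  have gs : invmx (g u) 0 1 = invmx (g u) 1 0.
    have [_ gs _] := gU.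
    have := congr1 (fun A : 'M[R]_2 => A 1 0) (trmx_inv (g u)).
    by rewrite gs // mxE.
  have Ps : P 0 1 = P 1 0 by rewrite /P (cvec_covD_sym oU oV hV fUV sf 1 0 Uu).
  by lra.
have := mean_curv_gt0 Uu; rewrite {1}/mean_curv ipZl gtrace_ip.
suff -> : \sum_i \sum_j invmx (g u) i j * '<sff g h f i j u, H u>_u = 0.
  by rewrite mulr0 ltxx.
rewrite -[RHS]T0; apply: eq_bigr => i _; apply: eq_bigr => j _; congr (_ * _).
rewrite sffE ipDl ipNl ip_suml big1 ?subr0 // => l _.
by rewrite ipZl ipS // Hn // mulr0.
Qed.

Lemma tangent_totally_real u i j : U u -> '<E i u *m J, E j u>_u = 0.
Proof.
move=> Uu; move: i j; apply: ord2P; apply: ord2P; rewrite ?ipJ0 //.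
  exact: kahler_form01_eq0.
by rewrite kahler_form01_swap // kahler_form01_eq0 ?oppr0.
Qed.

End TotallyReal.

(** * The moving frame of a Lagrangian surface *)

Section LagrangianFrame.
Context (R : realType) (U : set 'rV[R]_2) (V : set 'rV[R]_(2 + 2)).
Context (g : 'rV[R]_2 -> 'M[R]_2) (h : 'rV[R]_(2 + 2) -> 'M[R]_(2 + 2)).
Context (f : 'rV[R]_2 -> 'rV[R]_(2 + 2)) (J : 'M[R]_(2 + 2)) (r : R).
Hypotheses (oU : open U) (oV : open V) (gU : metric_on U g) (hV : metric_on V h).
Hypotheses (fUV : forall u, U u -> V (f u)) (sf : msmooth U f).
Hypothesis iso : forall u, U u -> forall X Y,
  ip h (f u) (dmap f u X) (dmap f u Y) = ip g u X Y.
Hypothesis JJ : J *m J = - 1%:M.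
Hypothesis Jherm : forall p, V p -> forall X Y, ip h p (X *m J) (Y *m J) = ip h p X Y.
Hypothesis Jpar : forall p, V p -> forall a b : 'I_(2 + 2),
  covD h id a (fun=> ('e_b : 'rV[R]_(2 + 2)) *m J) p
  = covD h id a (fun=> ('e_b : 'rV[R]_(2 + 2))) p *m J.
Local Notation H := (mean_curv g h f).
Local Notation E := (cvec f).
Local Notation "''<' v , w >_ u" := (ip h (f u) v w) (at level 0, u at level 0,
  v, w at level 200, format "''<' v ,  w >_ u").
Local Notation D := (covD h f).
Hypothesis r_gt0 : 0 < r.
Hypothesis HH : forall u, U u -> '<H u, H u>_u = r ^+ 2.
Hypothesis lag : forall u i j, U u -> '<E i u *m J, E j u>_u = 0.
Implicit Types (i j k : 'I_2) (u : 'rV[R]_2) (X Y : 'rV[R]_2 -> 'rV[R]_(2 + 2)).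

Let ipS u v w : U u -> '<v, w>_u = '<w, v>_u.
Proof. by move=> Uu; have [_ hs _] := hV; apply: ipC; apply: hs; apply: fUV. Qed.

Let ipJ u v w : U u -> '<v *m J, w>_u = - '<v, w *m J>_u.
Proof. by move=> Uu; apply: (ip_J JJ Jherm); apply: fUV. Qed.

Let ipJJ u v w : U u -> '<v *m J, w *m J>_u = '<v, w>_u.
Proof. by move=> Uu; apply: Jherm; apply: fUV. Qed.

Let ipJ0 u v : U u -> '<v *m J, v>_u = 0.
Proof. by move=> Uu; apply: (ip_JX0 hV JJ Jherm); apply: fUV. Qed.

Let r0 : r != 0. Proof. by rewrite gt_eqF. Qed.

Let Hn k u : U u -> '<H u, E k u>_u = 0.
Proof. exact: mean_curv_normal oU oV gU hV fUV sf iso k u. Qed.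

Lemma tangent_normal_eq0 u v : U u -> (forall k, '<v, E k u>_u = 0) ->
  (forall k, '<v, E k u *m J>_u = 0) -> v = 0.
Proof.
move=> Uu vE vEJ.
have rA i : row i (jac f u) = E i u by rewrite rowE.
have rB i : row i (jac f u *m J) = E i u *m J by rewrite row_mul rA.
apply: (@orth_blocks_eq0 R 2 2 h (f u) (jac f u) (jac f u *m J)).
- rewrite (_ : _ *m _ *m _ = g u) ?(metric_unit gU) //.
  by apply/matrixP => a b; rewrite mul_mx_ip !rA (cvec_ip iso).
- rewrite (_ : _ *m _ *m _ = g u) ?(metric_unit gU) //.
  by apply/matrixP => a b; rewrite mul_mx_ip !rB ipJJ // (cvec_ip iso).
- by move=> a b; rewrite rA rB ipS // lag.
- by move=> a; rewrite rA.
- by move=> a; rewrite rB.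
Qed.

(** The frame e1 = JH / r, e2, e3 = J e1, e4 = J e2, with e1 and e2 tangent, its
    dual coframe [theta1], [theta2] in coordinates, and its connection forms.
    The vector [rotJH] is a multiple of JH rotated by a right angle. *)
Definition e1 u : 'rV[R]_(2 + 2) := r^-1 *: (H u *m J).
Definition theta1 j u : R := '<E j u, e1 u>_u.
Definition rotJH u : 'rV[R]_(2 + 2) := theta1 1 u *: E 0 u - theta1 0 u *: E 1 u.
Definition e2 u : 'rV[R]_(2 + 2) := (Num.sqrt '<rotJH u, rotJH u>_u)^-1 *: rotJH u.
Definition e3 u : 'rV[R]_(2 + 2) := e1 u *m J.
Definition e4 u : 'rV[R]_(2 + 2) := e2 u *m J.
Definition theta2 j u : R := '<E j u, e2 u>_u.
Definition omega i u : R := '<D i e1 u, e2 u>_u.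
Definition alpha i u : R := '<D i e1 u, e3 u>_u.
Definition beta i u : R := '<D i e1 u, e4 u>_u.
Definition gamma i u : R := '<D i e2 u, e4 u>_u.

Lemma H_e3 u : H u = - r *: e3 u.
Proof. by rewrite /e3 /e1 -scalemxAl (mulJJ JJ) scaleNr !scalerN opprK scalerA mulfV ?scale1r. Qed.

Lemma e11 u : U u -> '<e1 u, e1 u>_u = 1.
Proof. by move=> Uu; rewrite ipZl ipZr ipJJ // HH //; field. Qed.

Lemma e1_EJ u k : U u -> '<e1 u, E k u *m J>_u = 0.
Proof. by move=> Uu; rewrite ipZl ipJJ // Hn ?mulr0. Qed.

Lemma rotJH_gt0 u : U u -> 0 < '<rotJH u, rotJH u>_u.
Proof.
move=> Uu; pose Z : 'rV[R]_2 := theta1 1 u *: 'e_0 - theta1 0 u *: 'e_1.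
have -> : rotJH u = dmap f u Z by rewrite /dmap mulmxBl -!scalemxAl.
rewrite iso //; have [_ _ gp] := gU; apply: gp => //.
apply/eqP => Z0.
have t10 : forall k, theta1 k u = 0.
  apply: ord2P.
    by move/rowP: Z0 => /(_ 1); rewrite !mxE /= => ?; lra.
  by move/rowP: Z0 => /(_ 0); rewrite !mxE /= => ?; lra.
have e10 : e1 u = 0.
  by apply: (@tangent_normal_eq0 u) => // k; [rewrite ipS //;
    exact: t10 | rewrite e1_EJ].
have := e11 Uu; rewrite e10 ip0l => /esym/eqP.
by rewrite oner_eq0.
Qed.

Lemma e12 u : U u -> '<e1 u, e2 u>_u = 0.
Proof.
move=> Uu; rewrite ipZr (_ : '<e1 u, rotJH u>_u = 0) ?mulr0 //.
by rewrite ipDr ipNr !ipZr ![ip _ _ (e1 u) _]ipS // -/(theta1 0 u) -/(theta1 1 u); ring.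
Qed.

Lemma e22 u : U u -> '<e2 u, e2 u>_u = 1.
Proof.
move=> Uu; have w0 := rotJH_gt0 Uu; rewrite ipZl ipZr.
by rewrite mulrA -invfM -expr2 sqr_sqrtr ?ltW // mulVf ?gt_eqF.
Qed.

Lemma e2_span u : e2 u = ((Num.sqrt '<rotJH u, rotJH u>_u)^-1 * theta1 1 u) *: E 0 u
  - ((Num.sqrt '<rotJH u, rotJH u>_u)^-1 * theta1 0 u) *: E 1 u.
Proof. by rewrite /e2 {2}/rotJH scalerBr !scalerA. Qed.

Lemma e2_EJ u k : U u -> '<e2 u, E k u *m J>_u = 0.
Proof.
move=> Uu; rewrite e2_span ipDl ipNl !ipZl.
have EJ j : '<E j u, E k u *m J>_u = 0 by rewrite ipS // lag.
by rewrite !EJ !mulr0 subr0.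
Qed.

Lemma e13 u : U u -> '<e1 u, e3 u>_u = 0.
Proof. by move=> Uu; rewrite ipS // ipJ0. Qed.
Lemma e24 u : U u -> '<e2 u, e4 u>_u = 0.
Proof. by move=> Uu; rewrite ipS // ipJ0. Qed.
Lemma e14 u : U u -> '<e1 u, e4 u>_u = 0.
Proof.
move=> Uu; rewrite /e4 e2_span mulmxBl -!scalemxAl ipDr ipNr !ipZr.
by rewrite !e1_EJ // !mulr0 subr0.
Qed.
Lemma e23 u : U u -> '<e2 u, e3 u>_u = 0.
Proof. by move=> Uu; rewrite ipS // ipJ // e14 ?oppr0. Qed.
Lemma e33 u : U u -> '<e3 u, e3 u>_u = 1.
Proof. by move=> Uu; rewrite ipJJ // e11. Qed.
Lemma e34 u : U u -> '<e3 u, e4 u>_u = 0.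
Proof. by move=> Uu; rewrite ipJJ // e12. Qed.
Lemma e44 u : U u -> '<e4 u, e4 u>_u = 1.
Proof. by move=> Uu; rewrite ipJJ // e22. Qed.
Lemma E_e3 u j : U u -> '<E j u, e3 u>_u = 0.
Proof. by move=> Uu; rewrite ipS // ipJ // e1_EJ ?oppr0. Qed.
Lemma E_e4 u j : U u -> '<E j u, e4 u>_u = 0.
Proof. by move=> Uu; rewrite ipS // ipJ // e2_EJ ?oppr0. Qed.

Lemma frame_expansion u v : U u ->
  v = '<v, e1 u>_u *: e1 u + '<v, e2 u>_u *: e2 u
    + '<v, e3 u>_u *: e3 u + '<v, e4 u>_u *: e4 u.
Proof.
move=> Uu; have [_ hs _] := hV; apply: orthonormal4_expansion; first exact: hs (fUV Uu).
- exact: e11.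
- exact: e12.
- exact: e13.
- exact: e14.
- exact: e22.
- exact: e23.
- exact: e24.
- exact: e33.
- exact: e34.
- exact: e44.
Qed.

(** All second covariant derivatives below are computed from this identity and
    the products <D_i e_a, e_b>: by metricity
    <D_i D_j X, Y> = d_i <D_j X, Y> - <D_j X, D_i Y>. *)
Lemma parseval u v w : U u -> '<v, w>_u = '<v, e1 u>_u * '<w, e1 u>_u
  + '<v, e2 u>_u * '<w, e2 u>_u + '<v, e3 u>_u * '<w, e3 u>_u
  + '<v, e4 u>_u * '<w, e4 u>_u.
Proof.
move=> Uu; have := frame_expansion v Uu.
move: (e1 u) (e2 u) (e3 u) (e4 u) => x y z t; set a := ip _ _ v _; set b := ip _ _ v _.
set c := ip _ _ v _; set d := ip _ _ v _; clearbody a b c d => ->.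
by rewrite !ipDl !ipZl ![ip _ _ _ w]ipS.
Qed.

Lemma e1_smooth : msmooth U e1.
Proof.
apply: msmoothZ => //; first exact: smooth_on_cst.
apply: msmoothM => //; last exact: msmooth_cst.
exact: (mean_curv_smooth oU oV gU hV fUV sf).
Qed.

Lemma ip_field_smooth X Y : msmooth U X -> msmooth U Y ->
  smooth_on U (fun q => '<X q, Y q>_q).
Proof. exact: (ip_smooth oU hV fUV sf). Qed.

Lemma E_smooth j : msmooth U (E j).
Proof. exact: (cvec_smooth oU sf). Qed.

Lemma theta1_smooth j : smooth_on U (theta1 j).
Proof. by apply: ip_field_smooth; [exact: E_smooth | exact: e1_smooth]. Qed.

Lemma rotJH_smooth : msmooth U rotJH.
Proof.
by apply: msmoothB => //; apply: msmoothZ => //; try exact: theta1_smooth;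
  exact: E_smooth.
Qed.

Lemma e2_smooth : msmooth U e2.
Proof.
apply: msmoothZ => //; last exact: rotJH_smooth.
apply: smooth_onV => //.
  by move=> q Uq; rewrite gt_eqF // sqrtr_gt0 rotJH_gt0.
apply: smooth_on_sqrt => //; first by move=> q Uq; exact: rotJH_gt0.
by apply: ip_field_smooth; exact: rotJH_smooth.
Qed.

Lemma mulJ_smooth X : msmooth U X -> msmooth U (fun q => X q *m J).
Proof. by move=> sX; apply: msmoothM => //; exact: msmooth_cst. Qed.

Lemma e3_smooth : msmooth U e3. Proof. exact: mulJ_smooth e1_smooth. Qed.
Lemma e4_smooth : msmooth U e4. Proof. exact: mulJ_smooth e2_smooth. Qed.

Lemma D_smooth i X : msmooth U X -> msmooth U (D i X).
Proof. exact: (covD_smooth oU oV hV fUV sf). Qed.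

Lemma theta2_smooth j : smooth_on U (theta2 j).
Proof. by apply: ip_field_smooth; [exact: E_smooth | exact: e2_smooth]. Qed.
Lemma omega_smooth j : smooth_on U (omega j).
Proof. by apply: ip_field_smooth; [exact: D_smooth e1_smooth | exact: e2_smooth]. Qed.
Lemma alpha_smooth j : smooth_on U (alpha j).
Proof. by apply: ip_field_smooth; [exact: D_smooth e1_smooth | exact: e3_smooth]. Qed.
Lemma beta_smooth j : smooth_on U (beta j).
Proof. by apply: ip_field_smooth; [exact: D_smooth e1_smooth | exact: e4_smooth]. Qed.
Lemma gamma_smooth j : smooth_on U (gamma j).
Proof. by apply: ip_field_smooth; [exact: D_smooth e2_smooth | exact: e4_smooth]. Qed.

Lemma D_ip i X Y u : U u -> msmooth U X -> msmooth U Y ->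
  '<D i X u, Y u>_u = pd i (fun q => '<X q, Y q>_q) u - '<X u, D i Y u>_u.
Proof.
move=> Uu sX sY.
by rewrite (pd_ip oU oV hV fUV sf i Uu (msmooth_diff sX Uu) (msmooth_diff sY Uu)) addrK.
Qed.

Lemma D_ip_cst i X Y (c : R) u : U u -> msmooth U X -> msmooth U Y ->
  (forall q, U q -> '<X q, Y q>_q = c) -> '<D i X u, Y u>_u = - '<X u, D i Y u>_u.
Proof.
move=> Uu sX sY XY; rewrite D_ip // (@pd_eq_on _ _ _ oU _ (fun=> c)) //.
by rewrite pd_cst sub0r.
Qed.

Lemma D_e3 i u : U u -> D i e3 u = D i e1 u *m J.
Proof. by move=> Uu; apply: (covD_J Jpar i fUV Uu);
  exact: msmooth_diff e1_smooth Uu. Qed.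
Lemma D_e4 i u : U u -> D i e4 u = D i e2 u *m J.
Proof. by move=> Uu; apply: (covD_J Jpar i fUV Uu);
  exact: msmooth_diff e2_smooth Uu. Qed.

Let D_self i X u : U u -> msmooth U X -> (forall q, U q -> '<X q, X q>_q = 1) ->
  '<D i X u, X u>_u = 0.
Proof.
move=> Uu sX XX; have := D_ip_cst i Uu sX sX XX.
by rewrite [ip _ _ (X u) _]ipS // => ?; lra.
Qed.

Lemma D11 i u : U u -> '<D i e1 u, e1 u>_u = 0.
Proof. by move=> Uu; apply: D_self => //; [exact: e1_smooth | move=> q;
  exact: e11]. Qed.
Lemma D22 i u : U u -> '<D i e2 u, e2 u>_u = 0.
Proof. by move=> Uu; apply: D_self => //; [exact: e2_smooth | move=> q;
  exact: e22]. Qed.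
Lemma D21 i u : U u -> '<D i e2 u, e1 u>_u = - omega i u.
Proof.
move=> Uu; rewrite (@D_ip_cst i e2 e1 0) //.
- by rewrite ipS.
- exact: e2_smooth.
- exact: e1_smooth.
- by move=> q Uq; rewrite ipS // e12.
Qed.
Lemma D32 i u : U u -> '<D i e3 u, e2 u>_u = - beta i u.
Proof. by move=> Uu; rewrite D_e3 // ipJ. Qed.
Lemma D23 i u : U u -> '<D i e2 u, e3 u>_u = beta i u.
Proof.
move=> Uu; rewrite (@D_ip_cst i e2 e3 0) //.
- by rewrite ipS // D32 // opprK.
- exact: e2_smooth.
- exact: e3_smooth.
- by move=> q Uq; rewrite e23.
Qed.
Lemma D31 i u : U u -> '<D i e3 u, e1 u>_u = - alpha i u.
Proof. by move=> Uu; rewrite D_e3 // ipJ. Qed.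
Lemma D33 i u : U u -> '<D i e3 u, e3 u>_u = 0.
Proof. by move=> Uu; rewrite D_e3 // ipJJ // D11. Qed.
Lemma D34 i u : U u -> '<D i e3 u, e4 u>_u = omega i u.
Proof. by move=> Uu; rewrite D_e3 // ipJJ. Qed.
Lemma D41 i u : U u -> '<D i e4 u, e1 u>_u = - beta i u.
Proof. by move=> Uu; rewrite D_e4 // ipJ // -/(e3 u) D23. Qed.
Lemma D42 i u : U u -> '<D i e4 u, e2 u>_u = - gamma i u.
Proof. by move=> Uu; rewrite D_e4 // ipJ. Qed.
Lemma D43 i u : U u -> '<D i e4 u, e3 u>_u = - omega i u.
Proof. by move=> Uu; rewrite D_e4 // ipJJ // D21. Qed.
Lemma D44 i u : U u -> '<D i e4 u, e4 u>_u = 0.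
Proof. by move=> Uu; rewrite D_e4 // ipJJ // D22. Qed.

(** The components of D_i E_j; its symmetry in i and j yields the structure
    equations of the coframe and the symmetry of the second fundamental form. *)
Lemma DE1 i j u : U u -> '<D i (E j) u, e1 u>_u = pd i (theta1 j) u
  - theta2 j u * omega i u.
Proof.
move=> Uu; rewrite D_ip //; [|exact: E_smooth|exact: e1_smooth].
congr (_ - _); rewrite (parseval (E j u) (D i e1 u) Uu) D11 // E_e3 // E_e4 //.
by rewrite -/(omega i u) -/(theta2 j u); ring.
Qed.

Lemma DE2 i j u : U u -> '<D i (E j) u, e2 u>_u = pd i (theta2 j) u
  + theta1 j u * omega i u.
Proof.
move=> Uu; rewrite D_ip //; [|exact: E_smooth|exact: e2_smooth].
congr (_ + _); rewrite (parseval (E j u) (D i e2 u) Uu) D21 // D22 // E_e3 // E_e4 //.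
by rewrite -/(theta1 j u); ring.
Qed.

Lemma DE3 i j u : U u -> '<D i (E j) u, e3 u>_u = theta1 j u * alpha i u
  + theta2 j u * beta i u.
Proof.
move=> Uu; rewrite (@D_ip_cst i (E j) e3 0) //; first last.
- by move=> q Uq; rewrite E_e3.
- exact: e3_smooth.
- exact: E_smooth.
rewrite (parseval (E j u) (D i e3 u) Uu) D31 // D32 // E_e3 // E_e4 //.
by rewrite -/(theta1 j u) -/(theta2 j u); ring.
Qed.

Lemma DE4 i j u : U u -> '<D i (E j) u, e4 u>_u = theta1 j u * beta i u
  + theta2 j u * gamma i u.
Proof.
move=> Uu; rewrite (@D_ip_cst i (E j) e4 0) //; first last.
- by move=> q Uq; rewrite E_e4.
- exact: e4_smooth.
- exact: E_smooth.
rewrite (parseval (E j u) (D i e4 u) Uu) D41 // D42 // E_e3 // E_e4 //.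
by rewrite -/(theta1 j u) -/(theta2 j u); ring.
Qed.

Let DEsym u : U u -> D 0 (E 1) u = D 1 (E 0) u.
Proof. exact: cvec_covD_sym oU oV hV fUV sf 0 1 u. Qed.

Lemma torsion1 u : U u ->
  pd 0 (theta1 1) u - theta2 1 u * omega 0 u = pd 1 (theta1 0) u
    - theta2 0 u * omega 1 u.
Proof. by move=> Uu; rewrite -!DE1 // DEsym. Qed.
Lemma torsion2 u : U u ->
  pd 0 (theta2 1) u + theta1 1 u * omega 0 u = pd 1 (theta2 0) u
    + theta1 0 u * omega 1 u.
Proof. by move=> Uu; rewrite -!DE2 // DEsym. Qed.
Lemma torsion3 u : U u ->
  theta1 1 u * alpha 0 u + theta2 1 u * beta 0 u = theta1 0 u * alpha 1 u
    + theta2 0 u * beta 1 u.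
Proof. by move=> Uu; rewrite -!DE3 // DEsym. Qed.
Lemma torsion4 u : U u ->
  theta1 1 u * beta 0 u + theta2 1 u * gamma 0 u = theta1 0 u * beta 1 u
    + theta2 0 u * gamma 1 u.
Proof. by move=> Uu; rewrite -!DE4 // DEsym. Qed.

Context (c : R).
Hypothesis Jsec : forall p, V p -> forall X : 'rV[R]_(2 + 2), X != 0 ->
  sec_curv h p X (X *m J) = c.

(** Each term of the curvature tensor of a space form contains a factor
    <JX, Y> with X and Y tangent, or a product of a tangent and a normal
    vector. *)
Lemma curv_tangent_eq0 i j u v w : U u ->
  (forall k, '<E k u *m J, v>_u = 0) -> (forall k, '<E k u, w>_u = 0) ->
  '<curv h (f u) (E i u) (E j u) v, w>_u = 0.
Proof.
move=> Uu vJ wE; rewrite (curv_space_form oV hV JJ Jherm Jpar Jsec) ?vJ ?wE;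
  last exact: fUV.
have -> : '<E i u, E j u *m J>_u = 0 by rewrite ipS // lag.
by ring.
Qed.

Let EJ1 k u : U u -> '<E k u *m J, e1 u>_u = 0.
Proof. by move=> Uu; rewrite ipS // e1_EJ. Qed.
Let EJ2 k u : U u -> '<E k u *m J, e2 u>_u = 0.
Proof. by move=> Uu; rewrite ipS // e2_EJ. Qed.

Let DDcomm X u v : U u -> msmooth U X -> (forall k, '<E k u *m J, X u>_u = 0) ->
  (forall k, '<E k u, v>_u = 0) ->
  '<D 0 (D 1 X) u, v>_u = '<D 1 (D 0 X) u, v>_u.
Proof.
move=> Uu sX XJ vE; apply/eqP; rewrite -subr_eq0 -ipNl -ipDl.
rewrite (covD_curv oV hV 0 1 oU fUV sf sX Uu).
by rewrite (curv_tangent_eq0 0 1 Uu XJ vE).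
Qed.

(** The components <R(E_0, E_1) e_a, e_b> = 0 with e_a tangent and e_b normal,
    that is d alpha = 2 omega ^ beta, d beta = omega ^ (gamma - alpha) and
    d gamma = - 2 omega ^ beta. *)
Lemma codazzi13 u : U u ->
  pd 0 (alpha 1) u + omega 1 u * beta 0 u - beta 1 u * omega 0 u
  = pd 1 (alpha 0) u + omega 0 u * beta 1 u - beta 0 u * omega 1 u.
Proof.
move=> Uu.
have F i j : '<D i (D j e1) u, e3 u>_u = pd i (alpha j) u + omega j u * beta i u
  - beta j u * omega i u.
  rewrite D_ip //; [|exact: D_smooth e1_smooth|exact: e3_smooth].
  rewrite (parseval (D j e1 u) (D i e3 u) Uu) D11 // D32 // D33 // D34 //.
  by rewrite -/(omega j u) -/(beta j u); set t := pd _ _ _; ring.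
rewrite -!F DDcomm //; [exact: e1_smooth | by move=> k; exact: EJ1 | by move=> k;
  exact: E_e3].
Qed.

Lemma codazzi14 u : U u ->
  pd 0 (beta 1) u + omega 1 u * gamma 0 u + alpha 1 u * omega 0 u
  = pd 1 (beta 0) u + omega 0 u * gamma 1 u + alpha 0 u * omega 1 u.
Proof.
move=> Uu.
have F i j : '<D i (D j e1) u, e4 u>_u = pd i (beta j) u + omega j u * gamma i u
  + alpha j u * omega i u.
  rewrite D_ip //; [|exact: D_smooth e1_smooth|exact: e4_smooth].
  rewrite (parseval (D j e1 u) (D i e4 u) Uu) D11 // D42 // D43 // D44 //.
  by rewrite -/(omega j u) -/(alpha j u); set t := pd _ _ _; ring.
rewrite -!F DDcomm //; [exact: e1_smooth | by move=> k; exact: EJ1 | by move=> k;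
  exact: E_e4].
Qed.

Lemma codazzi24 u : U u ->
  pd 0 (gamma 1) u - omega 1 u * beta 0 u + beta 1 u * omega 0 u
  = pd 1 (gamma 0) u - omega 0 u * beta 1 u + beta 0 u * omega 1 u.
Proof.
move=> Uu.
have F i j : '<D i (D j e2) u, e4 u>_u = pd i (gamma j) u - omega j u * beta i u
  + beta j u * omega i u.
  rewrite D_ip //; [|exact: D_smooth e2_smooth|exact: e4_smooth].
  rewrite (parseval (D j e2 u) (D i e4 u) Uu) D21 // D22 // D23 // D41 // D43 // D44 //.
  by set t := pd _ _ _; ring.
rewrite -!F DDcomm //; [exact: e2_smooth | by move=> k; exact: EJ2 | by move=> k;
  exact: E_e4].
Qed.

Lemma metricE i j u : U u -> g u i j = theta1 i u * theta1 j u
  + theta2 i u * theta2 j u.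
Proof.
move=> Uu; rewrite -(cvec_ip iso) // (parseval _ _ Uu) !E_e3 // !E_e4 //.
by rewrite -/(theta1 i u) -/(theta1 j u) -/(theta2 i u) -/(theta2 j u); ring.
Qed.

Let sff_normal_part i j u v : U u -> (forall k, '<E k u, v>_u = 0) ->
  '<sff g h f i j u, v>_u = '<D i (E j) u, v>_u.
Proof.
move=> Uu vE; rewrite sffE ipDl ipNl ip_suml big1 ?subr0 // => l _.
by rewrite ipZl vE mulr0.
Qed.

(** The components of H = - r e3 on e3 and e4 as traces of the second
    fundamental form. *)
Lemma mean_curv3 u : U u ->
  \sum_i \sum_j invmx (g u) i j * (alpha i u * theta1 j u + beta i u * theta2 j u)
    = - (2 * r).
Proof.
move=> Uu.
have : '<H u, e3 u>_u = - r by rewrite {1}H_e3 ipZl e33 // mulr1.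
rewrite /mean_curv ipZl gtrace_ip.
have -> : \sum_i \sum_j invmx (g u) i j * '<sff g h f i j u, e3 u>_u
   = \sum_i \sum_j invmx (g u) i j * (alpha i u * theta1 j u + beta i u * theta2 j u).
  apply: eq_bigr => i _; apply: eq_bigr => j _; congr (_ * _).
  rewrite sff_normal_part // => [|k]; last exact: E_e3.
  by rewrite DE3 // [alpha i u * _]mulrC [beta i u * _]mulrC.
by set t := \sum_i _ => e; lra.
Qed.

Lemma mean_curv4 u : U u ->
  \sum_i \sum_j invmx (g u) i j * (beta i u * theta1 j u + gamma i u * theta2 j u) = 0.
Proof.
move=> Uu.
have : '<H u, e4 u>_u = 0 by rewrite {1}H_e3 ipZl e34 // mulr0.
rewrite /mean_curv ipZl gtrace_ip.
have -> : \sum_i \sum_j invmx (g u) i j * '<sff g h f i j u, e4 u>_u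
   = \sum_i \sum_j invmx (g u) i j * (beta i u * theta1 j u + gamma i u * theta2 j u).
  apply: eq_bigr => i _; apply: eq_bigr => j _; congr (_ * _).
  rewrite sff_normal_part // => [|k]; last exact: E_e4.
  by rewrite DE4 // [beta i u * _]mulrC [gamma i u * _]mulrC.
by set t := \sum_i _ => e; lra.
Qed.

(** The coefficients c111 and c112 of alpha = c111 theta1 + c112 theta2, and the
    value rho of omega on e2, by Cramer's rule in the coframe.  The other
    coefficients of the cubic form are c122 = - (2 r + c111) and c222 = - c112,
    because its trace is - 2 r theta1. *)
Definition frame_det u : R := theta1 0 u * theta2 1 u - theta1 1 u * theta2 0 u.
Definition c111 u : R := (alpha 0 u * theta2 1 u
  - alpha 1 u * theta2 0 u) / frame_det u.
Definition c112 u : R := (alpha 1 u * theta1 0 u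
  - alpha 0 u * theta1 1 u) / frame_det u.
Definition rho u : R := (omega 1 u * theta1 0 u - omega 0 u * theta1 1 u) / frame_det u.

Lemma gram u : U u -> frame_det u != 0 /\ forall x y : 'I_2 -> R,
  (\sum_i \sum_j invmx (g u) i j * (x i * theta1 j u + y i * theta2 j u)) * frame_det u
  = x 0 * theta2 1 u - x 1 * theta2 0 u - y 0 * theta1 1 u + y 1 * theta1 0 u.
Proof.
move=> Uu; apply: (@gram_trace R (g u) (theta1^~ u) (theta2^~ u)).
  by move=> i j; exact: metricE.
exact: metric_unit gU _ Uu.
Qed.

Lemma frame_det_neq0 u : U u -> frame_det u != 0. Proof. by move=> /gram[]. Qed.

Lemma frame_det_smooth : smooth_on U frame_det.
Proof.
by apply: smooth_onB => //; apply: smooth_onM => //; (exact: theta1_smooth ||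
  exact: theta2_smooth).
Qed.

Lemma c111_smooth : smooth_on U c111.
Proof.
apply: smooth_onM => //; last by apply: smooth_onV => //;
  [exact: frame_det_neq0 | exact: frame_det_smooth].
by apply: smooth_onB => //; apply: smooth_onM => //; (exact: alpha_smooth ||
  exact: theta2_smooth).
Qed.

Lemma c112_smooth : smooth_on U c112.
Proof.
apply: smooth_onM => //; last by apply: smooth_onV => //;
  [exact: frame_det_neq0 | exact: frame_det_smooth].
by apply: smooth_onB => //; apply: smooth_onM => //; (exact: alpha_smooth ||
  exact: theta1_smooth).
Qed.

Lemma rho_smooth : smooth_on U rho.
Proof.
apply: smooth_onM => //; last by apply: smooth_onV => //;
  [exact: frame_det_neq0 | exact: frame_det_smooth].
by apply: smooth_onB => //; apply: smooth_onM => //; (exact: omega_smooth ||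
  exact: theta1_smooth).
Qed.

Lemma alphaE j u : U u -> alpha j u = c111 u * theta1 j u + c112 u * theta2 j u.
Proof.
move=> Uu; have := frame_det_neq0 Uu; rewrite /c111 /c112 /frame_det => d0.
by move: j; apply: ord2P; field.
Qed.

Lemma betaE j u : U u -> beta j u = c112 u * theta1 j u - (2 * r + c111 u) * theta2 j u.
Proof.
move=> Uu; have [d0 gr] := gram Uu.
have tr := gr (alpha^~ u) (beta^~ u); rewrite mean_curv3 // in tr.
have t3 := torsion3 Uu.
have -> : c112 u = (beta 0 u * theta2 1 u - beta 1 u * theta2 0 u) / frame_det u.
  by rewrite /c112; congr (_ / _); lra.
have -> : 2 * r + c111 u = (beta 0 u * theta1 1 u
  - beta 1 u * theta1 0 u) / frame_det u.
  by apply: (mulIf d0); rewrite mulrDl /c111 !divfK //; lra.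
by move: j d0; rewrite /frame_det; apply: ord2P => d0; field.
Qed.

Lemma gammaE j u : U u -> gamma j u = - (2 * r + c111 u) * theta1 j u
  - c112 u * theta2 j u.
Proof.
move=> Uu; have [d0 gr] := gram Uu.
have tr := gr (beta^~ u) (gamma^~ u); rewrite mean_curv4 // mul0r in tr.
have t4 := torsion4 Uu.
have b0 := betaE 0 Uu; have b1 := betaE 1 Uu.
have -> : - (2 * r + c111 u) = (gamma 0 u * theta2 1 u
  - gamma 1 u * theta2 0 u) / frame_det u.
  apply: (mulIf d0); rewrite [RHS]divfK //.
  transitivity (theta1 0 u * beta 1 u - theta1 1 u * beta 0 u); last by lra.
  by rewrite b0 b1 /frame_det; ring.
have -> : c112 u = (gamma 0 u * theta1 1 u - gamma 1 u * theta1 0 u) / frame_det u.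
  apply: (mulIf d0); rewrite [RHS]divfK //.
  transitivity (beta 0 u * theta2 1 u - beta 1 u * theta2 0 u); last by lra.
  by rewrite b0 b1 /frame_det; ring.
by move: j d0; rewrite /frame_det; apply: ord2P => d0; field.
Qed.

Let sdiff (s : 'rV[R]_2 -> R) u : smooth_on U s -> U u -> differentiable s u.
Proof. exact: smooth_on_diff. Qed.

Lemma pd_alpha i j u : U u -> pd i (alpha j) u = pd i c111 u * theta1 j u
  + c111 u * pd i (theta1 j) u
  + (pd i c112 u * theta2 j u + c112 u * pd i (theta2 j) u).
Proof.
move=> Uu.
have da := sdiff c111_smooth Uu; have db := sdiff c112_smooth Uu.
have d1 := sdiff (theta1_smooth j) Uu; have d2 := sdiff (theta2_smooth j) Uu.
rewrite (@pd_eq_on _ _ _ oU _ (fun q => c111 q * theta1 j q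
  + c112 q * theta2 j q)) //; last first.
  by move=> q Uq; exact: alphaE.
by rewrite pdD ?(pdM i da d1) ?(pdM i db d2) //; apply: differentiableM.
Qed.

Lemma pd_beta i j u : U u -> pd i (beta j) u = pd i c112 u * theta1 j u
  + c112 u * pd i (theta1 j) u
  - (pd i c111 u * theta2 j u + (2 * r + c111 u) * pd i (theta2 j) u).
Proof.
move=> Uu.
have da := sdiff c111_smooth Uu; have db := sdiff c112_smooth Uu.
have d1 := sdiff (theta1_smooth j) Uu; have d2 := sdiff (theta2_smooth j) Uu.
have dc : differentiable (fun _ : 'rV[R]_2 => 2 * r) u by exact: differentiable_cst.
have dca : differentiable (fun q => 2 * r + c111 q) u by exact: differentiableD.
rewrite (@pd_eq_on _ _ _ oU _ (fun q => c112 q * theta1 j q + - ((2 * r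
  + c111 q) * theta2 j q))) //; last first.
  by move=> q Uq; exact: betaE.
rewrite pdD; [|exact: differentiableM|by apply: differentiableN;
  exact: differentiableM].
rewrite pdN; last exact: differentiableM.
by rewrite (pdM i db d1) (pdM i dca d2) (pdD i dc da) pd_cst add0r.
Qed.

(** d (alpha + gamma) = 0 by the Codazzi equations and
    alpha + gamma = - 2 r theta1: the Maslov form of a Lagrangian surface of a
    space form is closed. *)
Lemma dtheta1_eq0 u : U u -> pd 0 (theta1 1) u = pd 1 (theta1 0) u.
Proof.
move=> Uu.
have S i j : pd i (alpha j) u + pd i (gamma j) u = - (2 * r) * pd i (theta1 j) u.
  rewrite -pdD; [|exact: sdiff (alpha_smooth j) Uu|exact: sdiff (gamma_smooth j) Uu].
  rewrite (@pd_eq_on _ _ _ oU _ (fun q => - (2 * r) * theta1 j q)) //.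
    rewrite pdM; [|exact: differentiable_cst|exact: sdiff (theta1_smooth j) Uu].
    by rewrite pd_cst mul0r add0r.
  by move=> q Uq; rewrite alphaE // gammaE //; ring.
have r2 : - (2 * r) != 0 by rewrite oppr_eq0 mulf_neq0 // pnatr_eq0.
apply: (mulfI r2); rewrite -!S.
have := codazzi13 Uu; have := codazzi24 Uu.
set x1 := pd 0 (alpha 1) u; set x2 := pd 0 (gamma 1) u; set x3 := pd 1 (alpha 0) u;
  set x4 := pd 1 (gamma 0) u.
by clearbody x1 x2 x3 x4 => ? ?; lra.
Qed.

Lemma omega_theta2 u : U u -> theta2 1 u * omega 0 u = theta2 0 u * omega 1 u.
Proof.
move=> Uu; have := torsion1 Uu; rewrite dtheta1_eq0 //.
by set x := pd _ _ _; clearbody x => ?; lra.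
Qed.

(** d theta1 = 0 says that omega ^ theta2 = 0, i.e. JH is a geodesic field. *)
Lemma omegaE j u : U u -> omega j u = rho u * theta2 j u.
Proof.
move=> Uu; have d0 := frame_det_neq0 Uu; have := omega_theta2 Uu => o.
apply: (mulIf d0); rewrite mulrAC /rho divfK //.
have o0 := congr1 (fun x => theta1 0 u * x) o; have o1 :=
  congr1 (fun x => theta1 1 u * x) o.
by move: j; apply: ord2P; rewrite /frame_det; rewrite /= in o0 o1; lra.
Qed.

Lemma perp_frame u v : U u -> (forall k, '<v, E k u>_u = 0) ->
  '<v, e1 u>_u = 0 /\ '<v, e2 u>_u = 0.
Proof.
move=> Uu vE; have d0 := frame_det_neq0 Uu.
have eq k : '<v, e1 u>_u * theta1 k u + '<v, e2 u>_u * theta2 k u = 0.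
  rewrite -[RHS](vE k) (parseval v (E k u) Uu) E_e3 // E_e4 //.
  by rewrite -/(theta1 k u) -/(theta2 k u); ring.
have := eq 0; have := eq 1; move: ('<v, e1 u>_u) ('<v, e2 u>_u) => a b q1 q0.
split; apply: (mulIf d0); rewrite mul0r /frame_det.
  transitivity ((a * theta1 0 u + b * theta2 0 u) * theta2 1 u - (a * theta1 1 u
    + b * theta2 1 u) * theta2 0 u).
    by ring.
  by rewrite q0 q1 !mul0r subr0.
transitivity ((a * theta1 1 u + b * theta2 1 u) * theta1 0 u - (a * theta1 0 u
  + b * theta2 0 u) * theta1 1 u).
  by ring.
by rewrite q0 q1 !mul0r subr0.
Qed.

Lemma christoffel_theta1 i j u : U u ->
  \sum_l conn g i u j l * theta1 l u = '<D i (E j) u, e1 u>_u.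
Proof.
move=> Uu; have [s _] := @perp_frame u (sff g h f i j u) Uu
  (fun k => sff_normal oU oV gU hV fUV sf iso i j k Uu).
move/eqP: s; rewrite sffE ipDl ipNl ip_suml subr_eq0 => /eqP ->.
by apply: eq_bigr => l _; rewrite ipZl.
Qed.

Lemma christoffel_theta2 i j u : U u ->
  \sum_l conn g i u j l * theta2 l u = '<D i (E j) u, e2 u>_u.
Proof.
move=> Uu; have [_ s] := @perp_frame u (sff g h f i j u) Uu
  (fun k => sff_normal oU oV gU hV fUV sf iso i j k Uu).
move/eqP: s; rewrite sffE ipDl ipNl ip_suml subr_eq0 => /eqP ->.
by apply: eq_bigr => l _; rewrite ipZl.
Qed.

Local Notation tau := (tension g h f).

Lemma tensionE q : tau q = - (2 * r) *: e3 q.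
Proof.
have -> : tau q = 2 *: H q by rewrite /mean_curv scalerA mulfV ?scale1r ?pnatr_eq0.
by rewrite H_e3 scalerA mulrN.
Qed.

Lemma D_tau j u : U u -> D j tau u = - (2 * r) *: D j e3 u.
Proof.
move=> Uu; rewrite -covDZ; last exact: msmooth_diff e3_smooth Uu.
by apply: (covD_eq_on h f oU j _ Uu) => q _; exact: tensionE.
Qed.

Lemma DD_tau i j u : U u -> D i (D j tau) u = - (2 * r) *: D i (D j e3) u.
Proof.
move=> Uu; rewrite -covDZ; last exact: msmooth_diff (D_smooth j e3_smooth) Uu.
by apply: (covD_eq_on h f oU i _ Uu) => q Uq; exact: D_tau.
Qed.

(** Tangential components of the bitension field; the curvature term drops out
    because the surface is totally real and JH is tangent. *)
Lemma bitension_ip u v : U u -> (forall k, '<E k u *m J, v>_u = 0) ->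
  '<e3 u, v>_u = 0 ->
  '<bitension g h f u, v>_u = - (2 * r) * \sum_i \sum_j invmx (g u) i j *
   ('<D i (D j e3) u, v>_u - \sum_l conn g i u j l * '<D l e3 u, v>_u).
Proof.
move=> Uu vJ v3; rewrite /bitension /rough_laplacian opprK ipDl ipNl !gtrace_ip.
have e3E k : '<e3 u, E k u>_u = 0 by rewrite ipS // E_e3.
rewrite [X in _ - X](_ : _ = 0) ?subr0; last first.
  apply: big1 => i _; apply: big1 => j _.
  rewrite (curv_space_form oV hV JJ Jherm Jpar Jsec); last exact: fUV.
  rewrite -/(cvec f i u) -/(cvec f j u) tensionE -scalemxAl.
  by rewrite !ipZl !ipZr v3 e3E !vJ lag //; ring.
rewrite mulr_sumr; apply: eq_bigr => i _; rewrite mulr_sumr; apply: eq_bigr => j _.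
rewrite mulrCA; congr (_ * _).
rewrite /covD2 DD_tau // ipDl ipNl ipZl ip_suml mulrBr; congr (_ - _).
rewrite mulr_sumr; apply: eq_bigr => l _; rewrite D_tau // !ipZl mulrCA;
  congr (_ * (_ * _)).
by rewrite covD_id_cst -rowE mxE.
Qed.

Hypothesis bicons : forall u, U u -> tan_part g h f u (bitension g h f u) = 0.

Let biconservative_along v u : U u -> (forall k, '<E k u *m J, v>_u = 0) ->
  '<e3 u, v>_u = 0 ->
  '<bitension g h f u, v>_u = 0 ->
  \sum_i \sum_j invmx (g u) i j *
   ('<D i (D j e3) u, v>_u - \sum_l conn g i u j l * '<D l e3 u, v>_u) = 0.
Proof.
move=> Uu vJ v3; rewrite bitension_ip // => /eqP; rewrite mulf_eq0 oppr_eq0 mulf_eq0.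
by rewrite pnatr_eq0 (negPf r0) => /eqP.
Qed.

Let bitension_tangent_eq0 u : U u ->
  '<bitension g h f u, e1 u>_u = 0 /\ '<bitension g h f u, e2 u>_u = 0.
Proof.
move=> Uu; apply: perp_frame => // k.
by rewrite -(tan_part_ip gU iso _ _ Uu) bicons // ip0l.
Qed.

(** The tangential components of the bitension field are, up to a constant
    factor, the divergences of alpha and beta corrected by the rotation of the
    frame; here they are multiplied by the determinant of the coframe. *)
Lemma biconservative_e1 u : U u ->
  pd 0 c111 u * theta2 1 u - pd 1 c111 u * theta2 0 u - pd 0 c112 u * theta1 1 u
    + pd 1 c112 u * theta1 0 u
  + c111 u * rho u * frame_det u = 0.
Proof.
move=> Uu; have [d0 gr] := gram Uu; have [b0 _] := bitension_tangent_eq0 Uu.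
have v3 : '<e3 u, e1 u>_u = 0 by rewrite ipS // e13.
have := biconservative_along Uu (fun k => EJ1 k Uu) v3 b0.
have -> : \sum_i \sum_j invmx (g u) i j *
   ('<D i (D j e3) u, e1 u>_u - \sum_l conn g i u j l * '<D l e3 u, e1 u>_u)
  = \sum_i \sum_j invmx (g u) i j *
   ((- pd i c111 u + 2 * c112 u * omega i u) * theta1 j u
    + (- pd i c112 u - c111 u * omega i u - (2 * r + c111 u) * omega i u
      - rho u * beta i u) * theta2 j u).
  apply: eq_bigr => i _; apply: eq_bigr => j _; congr (_ * _).
  rewrite D_ip //; [|exact: D_smooth e3_smooth|exact: e1_smooth].
  rewrite (@pd_eq_on _ _ _ oU _ (fun q => - alpha j q)) //; last by move=> q Uq;
    exact: D31.
  rewrite pdN; last exact: sdiff (alpha_smooth j) Uu.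
  rewrite (parseval (D j e3 u) (D i e1 u) Uu) D31 // D32 // D33 // D34 // D11 //.
  rewrite -/(omega i u) -/(alpha i u) -/(beta i u).
  have -> : \sum_l conn g i u j l * '<D l e3 u, e1 u>_u
    = - (c111 u * '<D i (E j) u, e1 u>_u + c112 u * '<D i (E j) u, e2 u>_u).
    rewrite -christoffel_theta1 // -christoffel_theta2 // !mulr_sumr -big_split -sumrN /=.
    by apply: eq_bigr => l _; rewrite D31 // alphaE //; ring.
  rewrite DE1 // DE2 // pd_alpha // (omegaE j Uu) (betaE j Uu).
  move: (pd i c111 u) (pd i c112 u) (pd i (theta1 j) u) (pd i (theta2 j) u) => x1 x2 x3 x4.
  by ring.
move=> e; have := gr (fun i => - pd i c111 u + 2 * c112 u * omega i u)
  (fun i => - pd i c112 u - c111 u * omega i u - (2 * r + c111 u) * omega i u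
    - rho u * beta i u).
rewrite e mul0r !omegaE // !betaE // /frame_det.
move: (pd 0 c111 u) (pd 1 c111 u) (pd 0 c112 u) (pd 1 c112 u) => x1 x2 x3 x4 ?; lra.
Qed.

Lemma biconservative_e2 u : U u ->
  pd 0 c112 u * theta2 1 u - pd 1 c112 u * theta2 0 u + pd 0 c111 u * theta1 1 u
    - pd 1 c111 u * theta1 0 u
  + c112 u * rho u * frame_det u = 0.
Proof.
move=> Uu; have [d0 gr] := gram Uu; have [_ b0] := bitension_tangent_eq0 Uu.
have v3 : '<e3 u, e2 u>_u = 0 by rewrite ipS // e23.
have := biconservative_along Uu (fun k => EJ2 k Uu) v3 b0.
have -> : \sum_i \sum_j invmx (g u) i j *
   ('<D i (D j e3) u, e2 u>_u - \sum_l conn g i u j l * '<D l e3 u, e2 u>_u)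
  = \sum_i \sum_j invmx (g u) i j *
   ((- pd i c112 u - (2 * r + c111 u) * omega i u - c111 u * omega i u) * theta1 j u
    + (pd i c111 u - 2 * c112 u * omega i u - rho u * gamma i u) * theta2 j u).
  apply: eq_bigr => i _; apply: eq_bigr => j _; congr (_ * _).
  rewrite D_ip //; [|exact: D_smooth e3_smooth|exact: e2_smooth].
  rewrite (@pd_eq_on _ _ _ oU _ (fun q => - beta j q)) //; last by move=> q Uq;
    exact: D32.
  rewrite pdN; last exact: sdiff (beta_smooth j) Uu.
  rewrite (parseval (D j e3 u) (D i e2 u) Uu) D31 // D32 // D33 // D34 // D21 // D22 //.
  rewrite -/(gamma i u).
  have -> : \sum_l conn g i u j l * '<D l e3 u, e2 u>_u
    = - (c112 u * '<D i (E j) u, e1 u>_u - (2 * r + c111 u) * '<D i (E j) u, e2 u>_u).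
    rewrite -christoffel_theta1 // -christoffel_theta2 // !mulr_sumr -sumrB -sumrN /=.
    by apply: eq_bigr => l _; rewrite D32 // betaE //; ring.
  rewrite DE1 // DE2 // pd_beta // (omegaE j Uu) (alphaE j Uu).
  move: (pd i c111 u) (pd i c112 u) (pd i (theta1 j) u) (pd i (theta2 j) u) => x1 x2 x3 x4.
  by ring.
move=> e; have := gr (fun i => - pd i c112 u - (2 * r + c111 u) * omega i u
  - c111 u * omega i u)
  (fun i => pd i c111 u - 2 * c112 u * omega i u - rho u * gamma i u).
rewrite e mul0r !omegaE // !gammaE // /frame_det.
move: (pd 0 c111 u) (pd 1 c111 u) (pd 0 c112 u) (pd 1 c112 u) => x1 x2 x3 x4 ?; lra.
Qed.

(** The Codazzi equation for alpha differs from the e2-component of the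
    bitension field exactly by 2 rho c112. *)
Lemma rho_c112 u : U u -> rho u * c112 u = 0.
Proof.
move=> Uu; have d0 := frame_det_neq0 Uu; have B := biconservative_e2 Uu; have C :=
  codazzi13 Uu.
have T := torsion2 Uu; have T1 := dtheta1_eq0 Uu.
rewrite !pd_alpha // T1 !omegaE // !betaE // in C; rewrite !omegaE // in T.
move: T1 C T B; rewrite /frame_det => _; move: d0; rewrite /frame_det => d0.
move: (pd 0 c111 u) (pd 1 c111 u) (pd 0 c112 u) (pd 1 c112 u) (pd 1 (theta1 0) u)
  (pd 0 (theta2 1) u) (pd 1 (theta2 0) u) => x1 x2 x3 x4 x5 x6 x7 C T B.
apply: (mulIf d0); rewrite mul0r.
have Tb : c112 u * (x6 + theta1 1 u * (rho u * theta2 0 u)) = c112 u * (x7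
  + theta1 0 u * (rho u * theta2 1 u)) by rewrite T.
lra.
Qed.

(** The Codazzi equation for beta differs from the e1-component of the
    bitension field exactly by 2 rho c122. *)
Lemma rho_c122 u : U u -> rho u * (2 * r + c111 u) = 0.
Proof.
move=> Uu; have d0 := frame_det_neq0 Uu; have B := biconservative_e1 Uu; have C :=
  codazzi14 Uu.
have T := torsion2 Uu; have T1 := dtheta1_eq0 Uu.
rewrite !pd_beta // T1 !omegaE // !gammaE // !alphaE // in C; rewrite !omegaE // in T.
move: T1 C T B; rewrite /frame_det => _; move: d0; rewrite /frame_det => d0.
move: (pd 0 c111 u) (pd 1 c111 u) (pd 0 c112 u) (pd 1 c112 u) (pd 1 (theta1 0) u)
  (pd 0 (theta2 1) u) (pd 1 (theta2 0) u) => x1 x2 x3 x4 x5 x6 x7 C T B.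
apply: (mulIf d0); rewrite mul0r.
have Tb : (2 * r + c111 u) * (x6 + theta1 1 u * (rho u * theta2 0 u))
  = (2 * r + c111 u) * (x7 + theta1 0 u * (rho u * theta2 1 u)) by rewrite T.
lra.
Qed.

(** Near a point where rho <> 0 the cubic form is - 2 r theta1^3, and
    [biconservative_e1] reduces to c111 rho = 0. *)
Lemma rho_eq0 u : U u -> rho u = 0.
Proof.
move=> Uu; apply/eqP; apply: contraT => k0.
have ck := differentiable_continuous (sdiff rho_smooth Uu).
have nearK : \forall q \near u, U q /\ rho q != 0.
  apply: filterI; first by apply: open_nbhs_nbhs.
  exact: (cvgr_neq0 (rho u) ck k0).
have B q : U q -> rho q != 0 -> c112 q = 0.
  by move=> Uq kq; have /eqP := rho_c112 Uq; rewrite mulf_eq0 (negPf kq) => /eqP.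
have A q : U q -> rho q != 0 -> c111 q = - (2 * r).
  move=> Uq kq; have /eqP := rho_c122 Uq; rewrite mulf_eq0 (negPf kq) addrC addr_eq0.
  by move=> /eqP.
have pda i : pd i c111 u = 0.
  rewrite (@pd_near _ _ _ _ (fun=> - (2 * r))) ?pd_cst //.
  by apply: filterS nearK => q [Uq kq]; exact: A.
have pdb i : pd i c112 u = 0.
  rewrite (@pd_near _ _ _ _ (fun=> 0)) ?pd_cst //.
  by apply: filterS nearK => q [Uq kq]; exact: B.
have := biconservative_e1 Uu;
  rewrite (pda 0) (pda 1) (pdb 0) (pdb 1) !mul0r !subr0 !add0r => /eqP.
rewrite (mulf_eq0 (c111 u * rho u)) (mulf_eq0 (c111 u)) (negPf k0) (negPf (frame_det_neq0 Uu)) !orbF A //.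
by rewrite oppr_eq0 mulf_eq0 pnatr_eq0 (negPf r0).
Qed.

(** The only normal component of D_i H = - r D_i e3 is - r omega_i e4. *)
Lemma lagrangian_PMC i u : U u -> norD g h f i H u = 0.
Proof.
move=> Uu.
have tanEJ v k : '<tan_part g h f u v, E k u *m J>_u = 0.
  by rewrite tan_partE ip_suml big1 // => j _; rewrite ipZl ipS // lag // mulr0.
rewrite /norD /nor_part; apply: (tangent_normal_eq0 Uu) => k.
  by rewrite ipDl ipNl (tan_part_ip gU iso) // subrr.
rewrite ipDl ipNl tanEJ subr0.
have -> : D i H u = - r *: D i e3 u.
  rewrite -covDZ; last exact: msmooth_diff e3_smooth Uu.
  by apply: (covD_eq_on h f oU i _ Uu) => q _; exact: H_e3.
rewrite ipZl (parseval (D i e3 u) (E k u *m J) Uu) EJ1 // EJ2 // D33 // D34 //.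
by rewrite omegaE // rho_eq0 //; ring.
Qed.

End LagrangianFrame.

(** * From charts to manifolds *)

(** The composite phi o x^-1 is continuous on the open image of the chart x, so
    that derivatives at a point of [locdom] only see [locdom]. *)
Lemma locdom_open (R : realType) (M N : topologicalType) (m n : nat) (phi : M -> N)
    (x : chart R M m) (y : chart R N n) : continuous phi -> open (locdom phi x y).
Proof.
move=> cphi; rewrite openE => u [xu yu].
have /subspace_continuousP cx := chart_inv_continuous (c := x).
have near_dom : \forall q \near u, chart_img x q -> chart_dom y (phi (chart_inv x q)).
  have ny : nbhs (phi (chart_inv x u)) (chart_dom y).
    by apply: open_nbhs_nbhs; split=> //; exact: chart_dom_open.
  exact: (cx u xu _ (cphi (chart_inv x u) _ ny)).
have near_img : \forall q \near u, chart_img x q.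
  by apply: open_nbhs_nbhs; split=> //; exact: chart_img_open.
by apply: filterS2 near_img near_dom => q xq yq; split=> //; exact: yq.
Qed.

Lemma gmx_metric_on (R : realType) (n : nat) (M : smooth_manifold R n)
    (g : riem_metric M) x : mcharts M x -> metric_on (chart_img x) (g x).
Proof.
move=> Mx; split=> [i j|p|p xp v v0].
- exact: gmx_smooth.
- exact: gmx_sym.
- exact: gmx_pos.
Qed.

Lemma metric_on_sub (R : realType) (n : nat) (U V : set 'rV[R]_n) g :
  U `<=` V -> metric_on V g -> metric_on U g.
Proof.
move=> UV [sg gs gp]; split=> [i j|p /UV|p /UV]; [|exact: gs|exact: gp].
exact: smooth_on_sub UV (sg i j).
Qed.

Lemma Jmx_sqr (R : realType) (n : nat) : Jmx R n *m Jmx R n = - 1%:M.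
Proof.
rewrite /Jmx mulmx_block !mul0mx !mulmx0 !add0r !addr0 mul1mx mulmx1.
by rewrite [in RHS]scalar_mx_block opp_block_mx !oppr0.
Qed.

Theorem theorem4p8 (R : realType) (c : R)
    (N : complex_manifold R 2) (h : riem_metric N)
    (N_space_form : complex_space_form h c)
    (M : smooth_manifold R 2) (M_oriented : oriented M) (g : riem_metric M)
    (phi : M -> N) (phi_isometric : isometric_immersion g h phi)
    (M_CMC : CMC g h phi)
    (M_biconservative : biconservative g h phi)
    (H_nonvanishing : nonvanishing_mean_curvature g h phi)
    (JT_is_normal : JT_normal g h phi) :
  PMC g h phi /\ totally_real h phi.
Proof.
have [Nkahler Nsec] := N_space_form.
have [[cphi sphi] phi_iso] := phi_isometric.
have [r Hr] := M_CMC.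
(* Both conclusions are pointwise in each pair of charts. *)
suff main x y u : mcharts M x -> mcharts N y -> locdom phi x y u ->
    (forall i, norD (g x) (h y) (locrep phi x y) i (meanH g h phi x y) u = 0) /\
    (forall X, is_normal (h y) (locrep phi x y) u (dmap (locrep phi x y) u X *m Jmx R 2)).
  by split=> x y Mx Ny u xyu; have [] := main x y u Mx Ny xyu.
move=> Mx Ny Uu.
set U := locdom phi x y in Uu; set V := chart_img y; set f := locrep phi x y.
have oU : open U by exact: locdom_open.
have oV : open V by exact: chart_img_open.
have hV : metric_on V (h y) by exact: gmx_metric_on.
have gU : metric_on U (g x).
  by apply: metric_on_sub (gmx_metric_on g Mx) => q [].
have fUV q : U q -> V (f q) by move=> [_ yq]; have [] := chart_mapP yq.
have sf : msmooth U f by move=> a b; rewrite (ord1 a); exact: sphi.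
have iso q : U q -> forall X Y, ip (h y) (f q) (dmap f q X) (dmap f q Y)
  = ip (g x) q X Y.
  by move=> Uq X Y; exact: phi_iso.
have JJ := Jmx_sqr R 2.
have Jherm p : V p -> forall X Y, ip (h y) p (X *m Jmx R 2) (Y *m Jmx R 2)
  = ip (h y) p X Y.
  by move=> Vp; have [] := Nkahler y Ny p Vp.
have Jpar p : V p -> forall a b : 'I_(2 + 2),
    covD (h y) id a (fun=> ('e_b : 'rV[R]_(2 + 2)) *m Jmx R 2) p
    = covD (h y) id a (fun=> ('e_b : 'rV[R]_(2 + 2))) p *m Jmx R 2.
  by move=> Vp; have [] := Nkahler y Ny p Vp.
have Jsec p : V p -> forall X : 'rV[R]_(2 + 2), X != 0 ->
  sec_curv (h y) p X (X *m Jmx R 2) = c.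
  by move=> Vp X; exact: Nsec.
have H0 q : U q -> mean_curv (g x) (h y) f q != 0 by exact: H_nonvanishing.
have JT q : U q ->
    is_normal (h y) f q (tan_part (g x) (h y) f q (mean_curv (g x) (h y) f q *m Jmx R 2) *m Jmx R 2).
  by move=> Uq; exact: JT_is_normal.
have lag q i j : U q -> ip (h y) (f q) (cvec f i q *m Jmx R 2) (cvec f j q) = 0.
  exact: (tangent_totally_real oU oV gU hV fUV sf iso JJ Jherm Jpar H0 JT).
have Hpos q : U q -> 0 < ip (h y) (f q) (mean_curv (g x) (h y) f q) (mean_curv (g x) (h y) f q).
  by move=> Uq; have [_ _ hp] := hV; apply: hp; [exact: fUV | exact: H0].
have Hnorm q : U q -> Num.sqrt (ip (h y) (f q) (mean_curv (g x) (h y) f q)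
    (mean_curv (g x) (h y) f q)) = r by exact: Hr.
have r_gt0 : 0 < r by rewrite -(Hnorm u Uu) sqrtr_gt0 Hpos.
have HH q : U q -> ip (h y) (f q) (mean_curv (g x) (h y) f q) (mean_curv (g x) (h y) f q) = r ^+ 2.
  by move=> Uq; rewrite -(Hnorm q Uq) sqr_sqrtr // ltW // Hpos.
have bicons q : U q -> tan_part (g x) (h y) f q (bitension (g x) (h y) f q) = 0.
  by move=> Uq; exact: M_biconservative.
split=> [i|X].
  exact: (lagrangian_PMC oU oV gU hV fUV sf iso JJ Jherm Jpar r_gt0 HH lag Jsec bicons).
apply/is_normalP => k; rewrite dmap_sum mulmx_suml ip_suml big1 // => j _.
by rewrite -scalemxAl ipZl lag // mulr0.
Qed.
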